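(* Let $R$ be a commutative Noetherian $\mathbb{N}$-graded ring, let $M$ be a finitely generated $\mathbb{Z}$-graded $R$-module, and let $N$ be a graded submodule of $M$. Let $I_1,\dots,I_r$ be homogeneous ideals of $R$, where for each $1\le i\le r$ the ideal $I_i$ is generated in degrees $d_{i,1},\dots,d_{i,a_i}$. Set $\mathbf{I}:=I_1\cdots I_r$ and $\mathbf{I}^{\underline{n}}:=I_1^{n_1}\cdots I_r^{n_r}$ for $\underline{n}=(n_1,\dots,n_r)\in\mathbb{N}^r$. Let $\mathcal{A}_N^M(\mathbf{I})$, $\mathcal{B}_N^M(\mathbf{I})$ and $\mathcal{B}_{\mathbf{I}N}^M(\mathbf{I})$ denote the stable values, for all $\underline{n}\gg\underline{0}$, of $\operatorname{Ass}_R(M/\mathbf{I}^{\underline{n}}N)$, $\operatorname{Ass}_R(\mathbf{I}^{\underline{n}}M/\mathbf{I}^{\underline{n}}N)$ and $\operatorname{Ass}_R(\mathbf{I}^{\underline{n}}M/\mathbf{I}^{\underline{n}+\underline{1}}N)$, respectively. Then the following hold. (1) For each $\mathfrak{p}\in\mathcal{B}_N^M(\mathbf{I})$, there exist $\underline{w}_1,\dots,\underline{w}_s\in\mathbb{N}^r$ and $c_1,\dots,c_s\in\mathbb{Z}$ such that $$v_{\mathfrak{p}}(\mathbf{I}^{\underline{n}}M/\mathbf{I}^{\underline{n}}N)=\min\{\underline{w}_k\cdot\underline{n}+c_k : 1\le k\le s\}\quad\text{for all }\underline{n}\gg\underline{0}.$$ Moreover, if $\underline{w}_k=(w_{k1},\dots,w_{kr})$,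 then $w_{ki}\in\{d_{i,1},\dots,d_{i,a_i}\}$ for all $k$ and $i$. (2) Suppose that $(0:_M I_k)=0$ for all $k=1,\dots,r$, and that $\mathbf{I}^{\underline{s}}M\subseteq N$ for some $\underline{s}\in\mathbb{N}^r$. Then for each $\mathfrak{p}\in\mathcal{A}_N^M(\mathbf{I})$ the same result holds for $v_{\mathfrak{p}}(M/\mathbf{I}^{\underline{n}}N)$; that is, there exist finitely many vectors $\underline{w}_1,\dots,\underline{w}_t\in\mathbb{N}^r$, with $i$th components $w_{ki}\in\{d_{i,1},\dots,d_{i,a_i}\}$, and integers $c_1,\dots,c_t$ such that $v_{\mathfrak{p}}(M/\mathbf{I}^{\underline{n}}N)=\min\{\underline{w}_k\cdot\underline{n}+c_k : 1\le k\le t\}$ for all $\underline{n}\gg\underline{0}$. (3) Suppose that $(0:_M I_k)=0$ for all $k=1,\dots,r$, and that $\mathbf{I}^{\underline{s}}M\subseteq N$ for some $\underline{s}\in\mathbb{N}^r$. Let $\mathfrak{p}\in\mathcal{B}_{\mathbf{I}N}^M(\mathbf{I})$ (hence $\mathfrak{p}\in\mathcal{A}_N^M(\mathbf{I})$). Then $v_{\mathfrak{p}}(\mathbf{I}^{\underline{n}}M/\mathbf{I}^{\underline{n}+\underline{1}}N)=v_{\mathfrak{p}}(M/\mathbf{I}^{\underline{n}+\underline{1}}N)$ for all $\underline{n}\gg\underline{0}$.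
   Context: $\mathbb{N}$ includes $0$. ''$I_i$ is generated in degrees $d_{i,1},\dots,d_{i,a_i}$'' means that $I_i$ is generated by finitely many homogeneous elements $y_{i,1},\dots,y_{i,a_i}$ with $\deg(y_{i,j})=d_{i,j}$. $\mathbb{Z}^r$ is ordered componentwise: $\underline{n}\ge\underline{m}$ iff $n_i\ge m_i$ for all $i$. $\underline{0}=(0,\dots,0)$, $\underline{1}=(1,\dots,1)$, and $\underline{m}\cdot\underline{n}=m_1n_1+\cdots+m_rn_r$. A property holds ''for all $\underline{n}\gg\underline{0}$'' if there is $\underline{m}\in\mathbb{N}^r$ such that it holds for all $\underline{n}\ge\underline{m}$. For an ideal $I$ of $R$ and a submodule $N\subseteq M$, $(N:_M I)=\{x\in M: Ix\subseteq N\}$. It is known (Hayasaka) that the sets $\operatorname{Ass}_R(M/\mathbf{I}^{\underline{n}}N)$ and $\operatorname{Ass}_R(\mathbf{I}^{\underline{n}}M/\mathbf{I}^{\underline{n}}N)$ are independent of $\underline{n}$ for all $\underline{n}\gg\underline{0}$ (for every graded submodule $N$, so also with $N$ replaced by $\mathbf{I}N$, where $\mathbf{I}^{\underline{n}}\mathbf{I}N=\mathbf{I}^{\underline{n}+\underline{1}}N$). Local $v$-number (local Vasconcelos invariant): for a finitely generated $\mathbb{Z}$-graded $R$-module $L$ and $\mathfrak{p}\in\operatorname{Ass}_R(L)$, $v_{\mathfrak{p}}(L):=\inf\{n\in\mathbb{Z}:\text{there exists }x\in L_n\text{ such that }\mathfrak{p}=(0:_R x)\}$. *)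

(* Defs.v *)
From HB Require Import structures.
From mathcomp Require Import all_boot all_order all_algebra.
From mathcomp Require Import generic_quotient ring_quotient.
From mathcomp Require Import boolp classical_sets constructive_ereal.

Set Implicit Arguments.
Unset Strict Implicit.
Unset Printing Implicit Defensive.

Import Order.TTheory GRing.Theory Num.Theory.

Local Open Scope ring_scope.
Local Open Scope quotient_scope.

Record submod (R : comPzRingType) (M : lmodType R) := Submod {
  submod_pred :> {pred M};
  submodP : submod_closed submod_pred
}.

HB.instance Definition _ (R : comPzRingType) (M : lmodType R) (N : submod M) :=
  GRing.isSubmodClosed.Build R M (submod_pred N) (submodP N).

(* The ideals of R are the submodules of the regular module R^o. *)
Notation ideal R := (submod R^o).

Section Submodules.
Variables (R : comPzRingType) (M : lmodType R).

Fact full_submod_closed : submod_closed (predT : {pred M}).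
Proof. by []. Qed.

Definition full : submod M := Submod full_submod_closed.

Definition imul_pred (J : ideal R) (N : submod M) : {pred M} :=
  [pred x | `[< exists s : seq (R * M),
     (forall u, u \in s -> u.1 \in J /\ u.2 \in N) /\
     x = \sum_(u <- s) u.1 *: u.2 >]].

Fact imul_submod_closed J N : submod_closed (imul_pred J N).
Proof.
split; first by apply/asboolP; exists [::]; split=> //; rewrite big_nil.
move=> a x y /asboolP[s [sP ->]] /asboolP[t [tP ->]]; apply/asboolP.
exists ([seq (a * u.1, u.2) | u <- s] ++ t); split.
  move=> u; rewrite mem_cat => /orP[/mapP[v vs ->]|/tP//] /=.
  by have [vJ vN] := sP _ vs; split=> //; exact: (@rpredZ R R^o J a).
rewrite big_cat big_map scaler_sumr; congr (_ + _).
by apply: eq_bigr => u _; rewrite scalerA.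
Qed.

(* J N, made of the finite sums of products *)
Definition imul J N : submod M := Submod (imul_submod_closed J N).

Definition generates (k : nat) (y : 'I_k -> M) (N : submod M) :=
  forall x, x \in N <-> exists c : 'I_k -> R, x = \sum_(j < k) c j *: y j.

Definition finitely_generated (N : submod M) :=
  exists k (y : 'I_k -> M), generates y N.

(* (N :_M J) *)
Definition colon (N : {pred M}) (J : ideal R) : {pred M} :=
  [pred x | `[< forall a, a \in J -> a *: x \in N >]].

End Submodules.

Arguments full {R} M.

Definition noetherian (R : comPzRingType) :=
  forall J : ideal R, finitely_generated J.

Section MultiPowers.
Variables (R : comPzRingType) (r : nat) (I : 'I_r -> ideal R).

Definition iexp (J : ideal R) (n : nat) : ideal R :=
  iter n (imul J) (full R^o).

(* I_1^{n_1} ... I_r^{n_r} *)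
Definition mpow (n : 'I_r -> nat) : ideal R :=
  \big[@imul R R^o/full R^o]_(i < r) iexp (I i) (n i).

End MultiPowers.

Definition for_large (r : nat) (P : ('I_r -> nat) -> Prop) :=
  exists m : 'I_r -> nat, forall n, (forall i, (m i <= n i)%N) -> P n.

Definition stable_value (T : Type) (r : nat) (F : ('I_r -> nat) -> T) (A : T) :=
  for_large (fun n => F n = A).

(* {x | x \in N} as an R-module *)
Section SubmoduleType.
Variables (R : comPzRingType) (M : lmodType R) (N : submod M).

Record submod_type : Type := SubmodElt { submod_val : M; _ : submod_val \in N }.
HB.instance Definition _ := [isSub for submod_val].
HB.instance Definition _ := [Choice of submod_type by <:].
HB.instance Definition _ :=
  [SubChoice_isSubZmodule of submod_type by <:].
HB.instance Definition _ :=
  [SubZmodule_isSubLmodule of submod_type by <:].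

End SubmoduleType.

(* The library makes the quotient group M/N a zmodType; we add the scalars. *)
Section QuotientModule.
Variables (R : comPzRingType) (M : lmodType R) (N : submod M).

Definition quot_mod : Type := Quotient.quot N.
HB.instance Definition _ := EqQuotient.on quot_mod.
HB.instance Definition _ := GRing.Zmodule.on quot_mod.

Definition quot_scale (a : R) (u : quot_mod) : quot_mod :=
  \pi_(Quotient.quot N) (a *: repr u).

Lemma quot_scale_pi a (x : M) :
  quot_scale a (\pi_(Quotient.quot N) x) = \pi_(Quotient.quot N) (a *: x).
Proof.
apply/eqP; rewrite -Quotient.idealrBE -scalerBr rpredZ //.
by rewrite Quotient.idealrBE reprK.
Qed.

Fact quot_scaleA a b u : quot_scale a (quot_scale b u) = quot_scale (a * b) u.
Proof. by rewrite [quot_scale b u]/quot_scale quot_scale_pi scalerA. Qed.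

Fact quot_scale1 : left_id 1 quot_scale.
Proof. by move=> u; rewrite /quot_scale scale1r reprK. Qed.

Fact quot_scaleDr : right_distributive quot_scale +%R.
Proof.
move=> a u v; rewrite -[u in LHS]reprK -[v in LHS]reprK -raddfD quot_scale_pi.
by rewrite scalerDr raddfD.
Qed.

Fact quot_scaleDl u : {morph quot_scale^~ u : a b / a + b}.
Proof. by move=> a b; rewrite /quot_scale scalerDl raddfD. Qed.

HB.instance Definition _ := GRing.Zmodule_isLmodule.Build R quot_mod
  quot_scaleA quot_scale1 quot_scaleDr quot_scaleDl.

End QuotientModule.

(* A / B for submodules B \subset A of M *)
Section Subquotient.
Variables (R : comPzRingType) (M : lmodType R) (A B : submod M).

Definition restr_pred : {pred submod_type A} := [pred x | val x \in B].

Fact restr_submod_closed : submod_closed restr_pred.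
Proof.
split=> [|a x y xB yB]; first by rewrite inE raddf0 rpred0.
by rewrite inE (linearP (\val : {linear submod_type A -> M})) rpredD ?rpredZ.
Qed.

Definition restr : submod (submod_type A) := Submod restr_submod_closed.

Definition subquot : Type := quot_mod restr.
HB.instance Definition _ := GRing.Lmodule.on subquot.

End Subquotient.

(* x is a finite sum of elements of the G i with distinct indices i *)
Definition decomposes (K : eqType) (V : zmodType) (G : K -> {pred V}) (x : V) :=
  exists (s : seq K) (f : K -> V),
    [/\ uniq s, forall i, i \in s -> f i \in G i & x = \sum_(i <- s) f i].

(* V is the internal direct sum of the subgroups G i *)
Definition is_grading (K : eqType) (V : zmodType) (G : K -> {pred V}) :=
  [/\ forall i, zmod_closed (G i),
      forall x, decomposes G x
    & forall (s : seq K) (f : K -> V), uniq s ->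
        (forall i, i \in s -> f i \in G i) ->
        \sum_(i <- s) f i = 0 -> forall i, i \in s -> f i = 0].

Definition ring_grading (R : comPzRingType) (Rg : nat -> {pred R}) :=
  [/\ is_grading Rg, 1 \in Rg 0%N
    & forall i j a b, a \in Rg i -> b \in Rg j -> a * b \in Rg (i + j)%N].

Definition module_grading (R : comPzRingType) (Rg : nat -> {pred R})
    (M : lmodType R) (Mg : int -> {pred M}) :=
  is_grading Mg /\
  forall (i : nat) (j : int) a x,
    a \in Rg i -> x \in Mg j -> a *: x \in Mg (i%:Z + j).

Definition graded_submod (K : eqType) (R : comPzRingType) (M : lmodType R)
    (G : K -> {pred M}) (N : submod M) :=
  forall x, x \in N -> decomposes (fun i => [predI G i & N]) x.

Definition generated_in_degrees (R : comPzRingType) (Rg : nat -> {pred R})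
    (J : ideal R) (a : nat) (d : 'I_a -> nat) :=
  exists y : 'I_a -> R^o, (forall j, y j \in Rg (d j)) /\ generates y J.

Definition sub_grading (R : comPzRingType) (M : lmodType R)
    (Mg : int -> {pred M}) (N : submod M) (i : int) :
    {pred submod_type N} :=
  [pred x | val x \in Mg i].

Definition quot_grading (R : comPzRingType) (M : lmodType R)
    (Mg : int -> {pred M}) (N : submod M) (i : int) :
    {pred quot_mod N} :=
  [pred u | `[< exists2 x, x \in Mg i & u = \pi_(Quotient.quot N) x >]].

Arguments sub_grading {R M} Mg N.
Arguments quot_grading {R M} Mg N.

Definition subquot_grading (R : comPzRingType) (M : lmodType R)
    (Mg : int -> {pred M}) (A B : submod M) : int -> {pred subquot A B} :=
  quot_grading (sub_grading Mg A) (restr A B).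

Arguments subquot_grading {R M} Mg A B.

Section AssociatedPrimes.
Variables (R : comPzRingType) (L : lmodType R).

Definition prime_ideal (p : {pred R}) :=
  [/\ submod_closed (p : {pred R^o}), 1 \notin p
    & forall a b, a * b \in p -> (a \in p) || (b \in p)].

(* (0 :_R x) *)
Definition ann (x : L) : {pred R} := [pred a | a *: x == 0].

Definition Ass : set {pred R} :=
  [set p | prime_ideal p /\ exists x : L, p =i ann x]%classic.

(* The infimum is taken in \bar int, so that it is +oo on the empty set and
   -oo on a set unbounded below. *)
Definition vnum (Lg : int -> {pred L}) (p : {pred R}) : \bar int :=
  infimum +oo%E
    [set n%:E%E | n in [set n : int | exists2 x, x \in Lg n & p =i ann x]]%classic.

End AssociatedPrimes.

Arguments Ass {R} L.

(* For n >> 0, v n is the minimum of finitely many (at least one) functions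
   w_k . n + c_k with w_k i among d i 1, ..., d i (a i). *)
Definition eventually_min_linear (r : nat) (a : 'I_r -> nat)
    (d : forall i, 'I_(a i) -> nat) (v : ('I_r -> nat) -> \bar int) :=
  exists (s : nat) (w : 'I_s -> 'I_r -> nat) (c : 'I_s -> int),
    [/\ (0 < s)%N,
        forall k i, exists j, w k i = d i j
      & for_large (fun n => v n =
          \big[Order.min/+oo%E]_(k < s)
             ((\sum_(i < r) w k i * n i)%N%:Z + c k)%:E%E)].

(* Main.v *)
Require Import Defs.
From HB Require Import structures.
From mathcomp Require Import all_boot all_order all_algebra.
From mathcomp Require Import generic_quotient ring_quotient zify.
From mathcomp Require Import boolp classical_sets functions constructive_ereal.

Set Implicit Arguments.
Unset Strict Implicit.
Unset Printing Implicit Defensive.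

Import Order.TTheory GRing.Theory Num.Theory.
Local Open Scope ring_scope.
Local Open Scope quotient_scope.

(** Fix a prime p and let x range over the homogeneous elements of I^n M with
    p x contained in I^n N. These numerators, for all n together, form a graded
    submodule of the multi-Rees module of M, which is finitely generated by a
    version of the Hilbert basis theorem ([hilbert_basis], [rees_bounded]). Let
    x_1, ..., x_k be homogeneous generators and let y_j be the given generators
    of the ideals. An element of I^n M whose annihilator modulo I^n N is p is an
    R-combination of terms y^g x_l. If all the terms of degree at most its own
    had an annihilator larger than p, then some element outside of p would kill
    them all, hence kill the element itself. As R lives in degrees at least 0,
    the local Vasconcelos number at n is therefore the least degree of a term
    y^g x_l of multidegree n with annihilator p
    ([realizes_eventually_min]).

    For fixed l, the exponents g of such terms form a down-closed set, since
    multiplying by a monomial only enlarges the annihilator. By Dickson's lemma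
    ([down_closed_cutoff]) membership in a down-closed set depends only on the
    coordinates truncated at some bound T. So g is one of finitely many
    truncated exponents, raised freely in the coordinates equal to T; for each
    ideal the cheapest way to raise it is along a free coordinate of least
    degree d_(i,j), which yields an affine function of n with slopes among the
    d_(i,j) ([eventually_min_down_closed]). This is (1).

    For (2) and (3), I^s M contained in N forces some I_i into p. If I_i kills no
    nonzero element of M, then (I^(n + e_i) M : I_i) = I^n M once n_i is large
    ([colon_stable]): the map x |-> (y_j x)_j embeds M into a power of M, and
    the colon submodules become a family to which the same finite generation
    applies. Hence all elements of M whose annihilator modulo I^(n + e_i) N is p
    lie in I^n M, so that (2) is (1) for the module I_i N in place of N, and the
    two invariants of (3) are infima of the same set. *)

(** * Submodules, products of ideals and multi-powers *)

Section SubmoduleBasics.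
Variables (R : comPzRingType) (M : lmodType R).
Implicit Types (N : submod M) (J : ideal R).

Lemma submod_ext N N' : N =i N' -> N = N'.
Proof.
case: N N' => [p Pp] [q Pq] epq.
have {}epq : p = q by apply/funext => x; have := epq x.
by case: _ / epq Pq => Pq; congr Submod.
Qed.

Section Comprehension.
Variables (P : M -> Prop) (P0 : P 0).
Hypothesis PD : forall a x y, P x -> P y -> P (a *: x + y).

Fact comprehension_closed :
  submod_closed ([pred x | `[< P x >]] : {pred M}).
Proof.
split; first exact/asboolP.
by move=> a x y /asboolP Px /asboolP Py; apply/asboolP/PD.
Qed.

Definition comprehension : submod M := Submod comprehension_closed.

Lemma comprehensionP x : x \in comprehension <-> P x.
Proof. by split=> /asboolP. Qed.

End Comprehension.

Lemma imul_mem J N a x : a \in J -> x \in N -> a *: x \in imul J N.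
Proof.
move=> aJ xN; apply/asboolP; exists [:: (a, x)]; split;
  last by rewrite big_seq1.
by move=> u; rewrite inE => /eqP->.
Qed.

Lemma imul_sub J N N' :
  (forall a x, a \in J -> x \in N -> a *: x \in N') -> {subset imul J N <= N'}.
Proof.
move=> h x /asboolP[s [sP ->]]; rewrite big_seq; apply: rpred_sum => u us.
by have [uJ uN] := sP u us; apply: h.
Qed.

Lemma imul_subN J N : {subset imul J N <= N}.
Proof. by apply: imul_sub => a x _; apply: rpredZ. Qed.

Lemma imul_monoN J N N' :
  {subset N <= N'} -> {subset imul J N <= imul J N'}.
Proof. by move=> h; apply: imul_sub => a x aJ /h xN; apply: imul_mem. Qed.

Lemma imul_full_ideal N : imul (full R^o) N = N.
Proof.
apply: submod_ext => x; apply/idP/idP; first exact: imul_subN.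
by move=> xN; rewrite -[x]scale1r; apply: imul_mem.
Qed.

End SubmoduleBasics.

Lemma imulA (R : comPzRingType) (M : lmodType R) (J J' : ideal R)
    (N : submod M) : imul J (imul J' N) = imul (imul J J') N.
Proof.
apply: submod_ext => x; apply/idP/idP; move: x.
  apply: imul_sub => a x aJ /asboolP[s [sP ->]].
  rewrite scaler_sumr big_seq; apply: rpred_sum => u /sP[uJ uN].
  rewrite scalerA; apply: imul_mem => //.
  exact: (@imul_mem R R^o).
apply: imul_sub => a x /asboolP[s [sP ->]] xN.
rewrite scaler_suml big_seq; apply: rpred_sum => u /sP[uJ uJ'].
have -> : (u.1 *: u.2) *: x = u.1 *: (u.2 *: x) by rewrite scalerA.
by apply: imul_mem => //; apply: imul_mem.
Qed.

Section IdealProducts.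
Variables (R : comPzRingType).
Implicit Types (J : ideal R).

Lemma imulC J J' : imul J J' = imul J' J.
Proof.
apply: submod_ext => x; apply/idP/idP; move: x; apply: imul_sub => a b aJ bJ;
  by rewrite /GRing.scale/= mulrC; apply: (imul_mem (M := R^o)).
Qed.

Lemma imul_full J : imul J (full R^o) = J.
Proof. by rewrite imulC imul_full_ideal. Qed.

(** The product of ideals is a commutative monoid law, so that the theory of
    iterated operators applies to multi-powers. *)
HB.instance Definition _ := Monoid.isComLaw.Build (ideal R) (full R^o)
  (@imul R R^o) (@imulA R R^o) imulC (@imul_full_ideal R R^o).

Lemma iexpD J k l : iexp J (k + l) = imul (iexp J k) (iexp J l).
Proof.
by elim: k => [|k IH]; rewrite ?imul_full_ideal// addSn /= IH imulA.
Qed.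

End IdealProducts.

(** The multi-indices carry the pointwise addition of functions; this is the
    unit vector e_i. *)
Definition unit_index r (i : 'I_r) : 'I_r -> nat := fun j => (j == i : nat).

Lemma multi_index_ind r (P : ('I_r -> nat) -> Prop) :
  P 0 -> (forall n i, P n -> P (n + unit_index i)) -> forall n, P n.
Proof.
move=> P0 PS n; move En: (\sum_i n i)%N => k.
elim: k n En => [|k IH] n En.
  suff -> : n = 0 by [].
  apply/funext => i; apply/eqP; rewrite -leqn0 -[X in (_ <= X)%N]En.
  by rewrite (bigD1 i)//= leq_addr.
have [[i ni]|n0] := pselect (exists i, (0 < n i)%N); last first.
  suff: (\sum_i n i = 0)%N by rewrite En.
  apply: big1 => i _; apply/eqP; rewrite -leqn0 leqNgt.
  by apply/negP => ni; apply: n0; exists i.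
set m : 'I_r -> nat := fun j => (n j - (j == i))%N.
have -> : n = m + unit_index i.
  apply/funext => j; rewrite /m.
  change (n j = n j - (j == i) + (j == i))%N.
  by case: eqP => [->|_]; rewrite ?subnK ?subn0 ?addn0.
apply/PS/IH/eqP; rewrite -eqSS -En (bigD1 i)//= [X in _ == X](bigD1 i)//=.
rewrite -addSn /m eqxx subn1 prednK //; apply/eqP; congr (_ + _)%N.
by apply: eq_bigr => j /negbTE->; rewrite subn0.
Qed.

Section MultiPowerTheory.
Variables (R : comPzRingType) (r : nat) (I : 'I_r -> ideal R).
Implicit Types (n m : 'I_r -> nat).

Lemma mpowD n m : mpow I (n + m) = imul (mpow I n) (mpow I m).
Proof.
rewrite /mpow -big_split; apply: eq_bigr => i _; exact: iexpD.
Qed.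

Lemma mpow0 : mpow I 0 = full R^o.
Proof. by rewrite /mpow big1. Qed.

Lemma mpow_unit i : mpow I (unit_index i) = I i.
Proof.
rewrite /mpow (bigD1 i)//= big1 ?imul_full /unit_index ?eqxx /= ?imul_full//.
by move=> j /negbTE->.
Qed.

End MultiPowerTheory.

(** * Noetherian modules *)

Definition noetherian_module (R : comPzRingType) (M : lmodType R) :=
  forall N : submod M, finitely_generated N.

Definition ascending (R : comPzRingType) (M : lmodType R)
    (K : nat -> submod M) :=
  forall s t, (s <= t)%N -> {subset K s <= K t}.

Lemma generates_mem (R : comPzRingType) (M : lmodType R) k (y : 'I_k -> M)
    (N : submod M) i : generates y N -> y i \in N.
Proof.
move=> genN; apply/genN; exists (fun j => (j == i)%:R).
rewrite (bigD1 i)//= eqxx scale1r big1 ?addr0// => j /negbTE->.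
by rewrite scale0r.
Qed.

Section NoetherianModules.
Variables (R : comPzRingType) (M : lmodType R).
Implicit Types (N : submod M).

Lemma fg_of_finite_family N (Q : finType) (y : Q -> M) :
  (forall q, y q \in N) ->
  (forall x, x \in N -> exists c : Q -> R, x = \sum_q c q *: y q) ->
  finitely_generated N.
Proof.
move=> yN genN; exists #|Q|, (y \o enum_val) => x; split=> [/genN[c ->]|[c ->]].
  exists (c \o enum_val); rewrite (reindex (fun i : 'I_#|Q| => enum_val i))//.
  exact/onW_bij/enum_val_bij.
by apply: rpred_sum => j _; apply: rpredZ; apply: yN.
Qed.

(** The y q generate N modulo N', so they complete generators of N'. *)
Lemma fg_extension N N' (Q : finType) (y : Q -> M) :
  finitely_generated N' -> {subset N' <= N} -> (forall q, y q \in N) ->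
  (forall x, x \in N -> exists c : Q -> R, x - \sum_q c q *: y q \in N') ->
  finitely_generated N.
Proof.
move=> [k [z zN']] N'N yN modN'.
pose w (u : Q + 'I_k) := match u with inl q => y q | inr j => z j end.
apply: (@fg_of_finite_family N _ w) => [[q|j]|x /modN'[c /zN'[b xE]]] //.
- exact: yN.
- exact: N'N (generates_mem j zN').
- exists (fun u => match u with inl q => c q | inr j => b j end).
  by rewrite big_sumType /= -xE addrC subrK.
Qed.

Lemma noetherian_acc (K : nat -> submod M) :
  noetherian_module M -> ascending K -> exists T, forall t, {subset K t <= K T}.
Proof.
move=> noeM ascK.
have U0 : exists t, 0 \in K t by exists 0%N; apply: rpred0.
have UD a x y : (exists t, x \in K t) -> (exists t, y \in K t) ->
    exists t, a *: x + y \in K t.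
  move=> [s xs] [t yt]; exists (maxn s t).
  apply: rpredD; first by apply: rpredZ; apply: ascK (leq_maxl s t) _ xs.
  exact: ascK (leq_maxr s t) _ yt.
have [k [y genU]] := noeM (comprehension U0 UD).
have /choice[T yT] : forall j, exists t, y j \in K t.
  by move=> j; apply/(comprehensionP U0 UD); apply: generates_mem.
exists (\max_j T j)%N => t x xt.
have /genU[c ->] : x \in comprehension U0 UD.
  by apply/comprehensionP; exists t.
apply: rpred_sum => j _; apply: rpredZ; apply: ascK (yT j).
exact: leq_bigmax.
Qed.

(** Only generators e_0, ..., e_(j-1) are used by the elements of the j-th
    submodule below; the coefficients of e_j modulo that submodule form an
    ideal, and lifts of its finitely many generators suffice to reduce from
    j + 1 to j. *)
Lemma noetherian_fg_module :
  noetherian R -> finitely_generated (full M) -> noetherian_module M.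
Proof.
move=> noeR [k [e gen_e]].
pose low j x := exists2 c : 'I_k -> R,
  (forall i : 'I_k, (j <= i)%N -> c i = 0) & x = \sum_i c i *: e i.
have low0 j : low j 0.
  by exists (fun=> 0) => //; rewrite big1 // => i _; rewrite scale0r.
have lowD j a x y : low j x -> low j y -> low j (a *: x + y).
  move=> [c c0 ->] [b b0 ->]; exists (fun i => a * c i + b i).
    by move=> i ji; rewrite c0 // b0 // mulr0 addr0.
  rewrite scaler_sumr -big_split; apply: eq_bigr => i _ /=.
  by rewrite scalerDl scalerA.
suff fg_low j N : {subset N <= comprehension (low0 j) (lowD j)} ->
    finitely_generated N.
  move=> N; apply: (fg_low k) => x _; apply/comprehensionP.
  have /gen_e[c ->] : x \in full M by [].
  by exists c => // i; rewrite leqNgt ltn_ord.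
elim: j N => [|j IH] N Nlow.
  exists 0%N, (fun=> 0) => x; split=> [xN|[c ->]]; last first.
    by rewrite big_ord0 rpred0.
  exists (fun=> 0); rewrite big_ord0.
  have /comprehensionP[c c0 ->] := Nlow x xN.
  by rewrite big1 // => i _; rewrite c0 ?scale0r.
have [kj|jk] := leqP k j.
  apply: IH => x /Nlow /comprehensionP[c _ ->]; apply/comprehensionP.
  by exists c => // i; rewrite leqNgt (leq_trans (ltn_ord i)).
pose o := Ordinal jk; set S := comprehension (low0 j) (lowD j).
pose lead (c : R^o) := exists2 z, z \in S & (c : R) *: e o + z \in N.
have lead0 : lead 0 by exists 0; rewrite ?scale0r ?addr0 rpred0.
have leadD a x y : lead x -> lead y -> lead (a *: x + y).
  move=> [z zS zN] [z' z'S z'N]; exists (a *: z + z').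
    by rewrite rpredD ?rpredZ.
  have -> : (a *: x + y : R) *: e o + (a *: z + z')
      = a *: ((x : R) *: e o + z) + ((y : R) *: e o + z').
    by rewrite scalerDl -[(a *: x : R) *: _]scalerA scalerDr addrACA.
  by rewrite rpredD ?rpredZ.
have [m [b gen_b]] := noeR (comprehension lead0 leadD).
have /choice[z zP] : forall l, exists z, z \in S /\ (b l : R) *: e o + z \in N.
  move=> l; have /comprehensionP[z] := generates_mem l gen_b.
  by exists z.
have NS0 : 0 \in N /\ 0 \in S by rewrite !rpred0.
have NSD a x y : x \in N /\ x \in S -> y \in N /\ y \in S ->
    a *: x + y \in N /\ a *: x + y \in S.
  by move=> [xN xS] [yN yS]; rewrite !rpredD ?rpredZ.
pose NS := comprehension NS0 NSD.
apply: (@fg_extension N NS _ (fun l => (b l : R) *: e o + z l)).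
- by apply: IH => x /(comprehensionP NS0 NSD)[].
- by move=> x /comprehensionP[].
- by move=> l; have [] := zP l.
move=> x xN; have /comprehensionP[c c0 xE] := Nlow x xN.
pose v := \sum_(i | i != o) c i *: e i.
have vS : v \in S.
  apply/comprehensionP; exists (fun i => if i == o then 0 else c i).
    move=> i ji; case: eqP => // io; apply: c0.
    by rewrite ltn_neqAle ji andbT; apply/eqP => E; apply: io; apply: val_inj.
  rewrite (bigD1 o)//= eqxx scale0r add0r; apply: eq_bigr => i /negbTE io.
  by rewrite io.
have xv : x = c o *: e o + v by rewrite xE (bigD1 o).
have /gen_b[w cE] : (c o : R^o) \in comprehension lead0 leadD.
  by apply/comprehensionP; exists v; rewrite -?xv.
exists w; apply/comprehensionP; split.
  apply: rpredB => //; apply: rpred_sum => l _; apply: rpredZ.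
  by have [] := zP l.
suff -> : x - \sum_l w l *: ((b l : R) *: e o + z l) = v - \sum_l w l *: z l.
  apply: rpredB => //; apply: rpred_sum => l _; apply: rpredZ.
  by have [] := zP l.
rewrite xv cE scaler_suml.
under [X in _ - X]eq_bigr do rewrite scalerDr scalerA.
by rewrite big_split /= opprD addrACA subrr add0r.
Qed.

End NoetherianModules.

Lemma fg_full_power (R : comPzRingType) (M : lmodType R) (A : finType) :
  finitely_generated (full M) -> finitely_generated (full (A -> M)).
Proof.
move=> [k [y geny]].
pose w (u : A * 'I_k) : A -> M := fun i => if i == u.1 then y u.2 else 0.
apply: (@fg_of_finite_family _ _ (full (A -> M)) _ w) => // x _.
have /choice[c xE] i : exists c : 'I_k -> R, x i = \sum_j c j *: y j.
  exact/geny.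
exists (fun u => c u.1 u.2); apply/funext => i.
rewrite -(pair_bigA _ (fun i' j => c i' j *: w (i', j))) /= fct_sumE.
rewrite (bigD1 i)//= [X in _ + X]big1 => [|i' /negbTE i'i]; last first.
  rewrite fct_sumE; apply: big1 => j _.
  rewrite /w; change (c i' j *: (if i == i' then y j else 0) = 0).
  by rewrite eq_sym i'i scaler0.
rewrite addr0 fct_sumE xE; apply: eq_bigr => j _.
by change (c i j *: y j = c i j *: (if i == i then y j else 0)); rewrite eqxx.
Qed.

(** * The Hilbert basis theorem for commuting operators *)

Section HilbertBasis.
Variables (R : comPzRingType) (V : lmodType R) (J : eqType).
Variable Y : J -> {linear V -> V}.
Hypothesis Ycomm : forall i j x, Y i (Y j x) = Y j (Y i x).
Implicit Types (s : seq J) (j : J) (W K : submod V).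

Definition stable_under s K :=
  forall j, j \in s -> forall x, x \in K -> Y j x \in K.

(** The ascending chain condition for the submodules of W that are stable under
    the operators indexed by s. With s empty this is the usual one; with W = M
    and one operator per variable it says that a module over the polynomial
    ring is Noetherian. *)
Definition acc_under s W := forall K : nat -> submod V, ascending K ->
  (forall t, stable_under s (K t)) -> (forall t, {subset K t <= W}) ->
  exists T, forall t, {subset K t <= K T}.

(** Polynomials in Y_j of degree less than t. Their coefficients in W are not
    unique, as the operators may satisfy relations. *)
Fixpoint poly_in j W (t : nat) (x : V) : Prop :=
  if t is t'.+1 then
    exists z v, [/\ poly_in j W t' z, v \in W & x = z + iter t' (Y j) v]
  else x = 0.

Let iterD j t a x y :
  iter t (Y j) (a *: x + y) = a *: iter t (Y j) x + iter t (Y j) y.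
Proof. by elim: t => //= t ->; rewrite linearP. Qed.

Let iter0 j t : iter t (Y j) 0 = 0.
Proof. by elim: t => //= t ->; rewrite linear0. Qed.

Let iterC i j t x : Y i (iter t (Y j) x) = iter t (Y j) (Y i x).
Proof. by elim: t => //= t <-; rewrite Ycomm. Qed.

Lemma poly_in0 j W t : poly_in j W t 0.
Proof.
elim: t => //= t IH; exists 0, 0.
by split; rewrite ?rpred0 ?iter0 ?addr0.
Qed.

Lemma poly_inD j W t a x y :
  poly_in j W t x -> poly_in j W t y -> poly_in j W t (a *: x + y).
Proof.
elim: t x y => [_ _ -> ->|t IH x y] /=; first by rewrite scaler0 addr0.
move=> [z [v [pz vW ->]]] [z' [v' [pz' v'W ->]]].
exists (a *: z + z'), (a *: v + v'); split; first exact: IH.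
  by rewrite rpredD ?rpredZ.
by rewrite iterD scalerDr addrACA.
Qed.

Lemma poly_in_le j W t t' x :
  (t <= t')%N -> poly_in j W t x -> poly_in j W t' x.
Proof.
move=> /subnK <-; elim: (t' - t)%N => //= k IH px; exists x, 0.
by split; [exact: IH|rewrite rpred0|rewrite iter0 addr0].
Qed.

Lemma poly_in_shift j W t x : poly_in j W t x -> poly_in j W t.+1 (Y j x).
Proof.
elim: t x => [_ ->|t IH x [z [v [pz vW ->]]]]; 
  first by rewrite linear0; apply: poly_in0.
by exists (Y j z), v; split; [exact: IH| |rewrite linearD].
Qed.

Lemma poly_in_stable i j W t x : (forall x, x \in W -> Y i x \in W) ->
  poly_in j W t x -> poly_in j W t (Y i x).
Proof.
move=> Wi; elim: t x => [_ ->|t IH x [z [v [pz vW ->]]]];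
  first by rewrite linear0.
by exists (Y i z), (Y i v); rewrite linearD iterC;
  split; [exact: IH|exact: Wi|].
Qed.

Fact adjoin0 j W : exists t, poly_in j W t 0.
Proof. by exists 0%N. Qed.

Fact adjoinD j W a x y : (exists t, poly_in j W t x) ->
  (exists t, poly_in j W t y) -> exists t, poly_in j W t (a *: x + y).
Proof.
move=> [t px] [t' py]; exists (maxn t t').
by apply: poly_inD; [apply: poly_in_le px; exact: leq_maxl|
  apply: poly_in_le py; exact: leq_maxr].
Qed.

Definition adjoin j W := comprehension (@adjoin0 j W) (@adjoinD j W).

Lemma sub_adjoin j W : {subset W <= adjoin j W}.
Proof.
by move=> x xW; apply/comprehensionP; exists 1%N, 0, x; rewrite add0r.
Qed.

Lemma stable_adjoin j s W :
  stable_under s W -> stable_under (j :: s) (adjoin j W).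
Proof.
move=> Ws i; rewrite inE => /orP[/eqP ->|js] x /comprehensionP[t px].
  by apply/comprehensionP; exists t.+1; apply: poly_in_shift.
by apply/comprehensionP; exists t; apply: poly_in_stable px => {}x; apply: Ws.
Qed.

Section LeadingCoefficients.
Variables (j : J) (W : submod V).

Let lead K t v :=
  v \in W /\ exists2 z, poly_in j W t z & z + iter t (Y j) v \in K.

Fact lead0 K t : lead K t 0.
Proof.
split; rewrite ?rpred0 //; exists 0; rewrite ?iter0 ?addr0 ?rpred0//.
exact: poly_in0.
Qed.

Fact leadD K t a x y : lead K t x -> lead K t y -> lead K t (a *: x + y).
Proof.
move=> [xW [z pz zK]] [yW [z' pz' z'K]]; split; first by rewrite rpredD ?rpredZ.
exists (a *: z + z'); first exact: poly_inD.
by rewrite iterD addrACA -scalerDr rpredD ?rpredZ.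
Qed.

(** As representations are not unique, all the possible leading coefficients of
    the elements of K are collected. *)
Definition leading K t := comprehension (@lead0 K t) (@leadD K t).

Lemma leading_le K t t' : (forall x, x \in K -> Y j x \in K) ->
  (t <= t')%N -> {subset leading K t <= leading K t'}.
Proof.
move=> Kj /subnK <-; elim: (t' - t)%N => [//|k IH] v /IH.
move=> /comprehensionP[vW [z pz zK]]; apply/comprehensionP; split=> //.
exists (Y j z); first exact: poly_in_shift.
by rewrite addSn /= -linearD; apply: Kj.
Qed.

Lemma leading_sub K K' t :
  {subset K <= K'} -> {subset leading K t <= leading K' t}.
Proof.
move=> KK' v /comprehensionP[vW [z pz zK]]; apply/comprehensionP; split=> //.
by exists z => //; exact: KK'.
Qed.

Lemma stable_leading s K t :
  stable_under s W -> stable_under s K -> stable_under s (leading K t).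
Proof.
move=> Ws Ks i si v /comprehensionP[vW [z pz zK]]; apply/comprehensionP.
split; first exact: Ws.
exists (Y i z); first by apply: poly_in_stable pz; exact: Ws.
by rewrite -iterC -linearD; apply: Ks.
Qed.

(** Nested submodules with the same leading coefficients agree: subtracting an
    element of the smaller one lowers the degree. *)
Lemma leading_inj K K' : {subset K <= K'} ->
  (forall t, {subset leading K' t <= leading K t}) ->
  forall x, x \in adjoin j W -> x \in K' -> x \in K.
Proof.
move=> KK' L x /comprehensionP[t]; elim: t x => [_ -> _|t IH x];
  first exact: rpred0.
move=> [z [v [pz vW xE]]] xK'.
have : v \in leading K' t.
  by apply/comprehensionP; split => //; exists z; rewrite -?xE.
move=> /L/comprehensionP[_ [z' pz' z'K]].
suff h : z - z' \in K.
  rewrite xE -[z](subrK z') -addrA; exact: rpredD.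
apply: IH.
  by rewrite addrC -scaleN1r; apply: poly_inD.
have -> : z - z' = x - (z' + iter t (Y j) v).
  by rewrite xE opprD addrACA subrr addr0.
by apply: rpredB => //; apply: KK'.
Qed.

(** The leading coefficients of K_u in degree t increase with u and with t. The
    diagonal u = t becomes stationary at some D; this controls all degrees
    t >= D at once, and the finitely many degrees below D are treated
    separately. *)
Lemma acc_adjoin s : acc_under s W -> stable_under s W ->
  acc_under (j :: s) (adjoin j W).
Proof.
move=> accW Ws K ascK Kst KW.
have Kj u x : x \in K u -> Y j x \in K u by apply: Kst; rewrite mem_head.
have Ks u : stable_under s (K u).
  by move=> i si; apply: Kst; rewrite inE si orbT.
have LW u t : {subset leading (K u) t <= W} by move=> v /comprehensionP[].
have accL t : exists U, forall u, {subset leading (K u) t <= leading (K U) t}.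
  apply: accW => [u u' uu'|u|u]; last exact: LW.
    by apply: leading_sub; apply: ascK.
  by apply: stable_leading => //; apply: Ks.
have [D diag] : exists D, forall u, {subset leading (K u) u <= leading (K D) D}.
  apply: (accW (fun u => leading (K u) u)) => [u u' uu'|u|u]; last exact: LW.
    move=> v /(leading_le (@Kj u) uu'); apply: leading_sub; exact: ascK.
  by apply: stable_leading => //; apply: Ks.
have /choice[U UP] := accL.
exists (maxn D (\max_(t < D) U t))%N; set T := maxn _ _ => u x xK.
have Tu : (T <= maxn u T)%N by apply: leq_maxr.
apply: (leading_inj (ascK _ _ Tu)); first last.
- exact: ascK (leq_maxl _ _) _ xK.
- exact: KW xK.
move=> t v; have [tD|Dt] := ltnP t D.
  move=> /UP; apply: leading_sub; apply: ascK.
  rewrite leq_max (leq_bigmax (Ordinal tD)) orbT //.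
move=> /(leading_le (@Kj _) (leq_maxl t (maxn u T))).
move=> /(leading_sub (ascK _ _ (leq_maxr t _))) /diag.
move=> /(leading_le (@Kj _) Dt); apply: leading_sub; apply: ascK.
exact: leq_maxl.
Qed.

End LeadingCoefficients.

Definition adjoin_all s W := foldr adjoin W s.

Lemma sub_adjoin_all s W : {subset W <= adjoin_all s W}.
Proof. by elim: s => //= j s IH x /IH; exact: sub_adjoin. Qed.

Lemma stable_adjoin_all s W : stable_under s (adjoin_all s W).
Proof. by elim: s => //= j s IH; exact: stable_adjoin. Qed.

Lemma hilbert_basis s W : acc_under [::] W -> acc_under s (adjoin_all s W).
Proof.
move=> accW; elim: s => //= j s IH; apply: acc_adjoin => //.
exact: stable_adjoin_all.
Qed.

End HilbertBasis.

(** * Families of submodules stable under the multi-Rees algebra *)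

Section ReesFamilies.
Variables (R : comPzRingType) (M : lmodType R) (r : nat).
Variables (J : finType) (h : J -> 'I_r) (y : J -> R).
Implicit Types (n m : 'I_r -> nat) (K Z : ('I_r -> nat) -> submod M).

(** A family of submodules stable under the generators y_j, where y_j raises the
    multidegree by e_(h j). Such families are the multigraded submodules over
    the multi-Rees algebra. *)
Definition rees_family K := forall j n x,
  x \in K n -> y j *: x \in K (n + unit_index (h j)).

(** The direct sum of copies of M indexed by the multidegrees sits inside this
    module of all functions, where y_j acts as a shift operator. *)
Let V : Type := ('I_r -> nat) -> M.

Definition pred_index n (i : 'I_r) : 'I_r -> nat := fun l => (n l - (l == i))%N.

Definition shift j (f : V) : V :=
  fun n => if (0 < n (h j))%N then y j *: f (pred_index n (h j)) else 0.

Fact shift_linear j : linear (shift j).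
Proof.
move=> a f g; apply/funext => n.
change (shift j (a *: f + g) n = a *: shift j f n + shift j g n).
rewrite /shift; case: ifP => _; last by rewrite scaler0 addr0.
set p := pred_index _ _.
change (y j *: (a *: f p + g p) = a *: (y j *: f p) + y j *: g p).
by rewrite scalerDr !scalerA mulrC.
Qed.

HB.instance Definition _ j :=
  GRing.isLinear.Build R V V *:%R (shift j) (shift_linear j).

Fact shiftC i j f : shift i (shift j f) = shift j (shift i f).
Proof.
apply/funext => n; cbv beta delta [shift pred_index].
have [->|_] := eqVneq (h i) (h j).
  case: (0 < n (h j))%N; case: (0 < n (h j) - true)%N; rewrite ?scaler0 //.
  by rewrite !scalerA mulrC.
rewrite !subn0.
case: (0 < n (h i))%N; case: (0 < n (h j))%N; rewrite ?scaler0 //.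
rewrite !scalerA mulrC; congr (_ *: f _).
by apply/funext => l; rewrite -!subnDA addnC.
Qed.

Definition single n (x : M) : V := fun m => if `[< m = n >] then x else 0.

Lemma single_id n x : single n x n = x.
Proof. by rewrite /single; case: asboolP. Qed.

Lemma single_out n x m : m <> n -> single n x m = 0.
Proof. by rewrite /single; case: asboolP. Qed.

Lemma singleD n a x x' : single n (a *: x + x') = a *: single n x + single n x'.
Proof.
apply/funext => m.
change (single n (a *: x + x') m = a *: single n x m + single n x' m).
by rewrite /single; case: asboolP => _ //; rewrite scaler0 addr0.
Qed.

Lemma shift_single j n x :
  shift j (single n x) = single (n + unit_index (h j)) (y j *: x).
Proof.
apply/funext => m; rewrite /shift.
have [->|mn] := pselect (m = n + unit_index (h j)).
  rewrite single_id.
  have -> : (0 < (n + unit_index (h j))%R (h j))%N.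
    change (0 < n (h j) + unit_index (h j) (h j))%N.
    by rewrite /unit_index eqxx addn1.
  congr (_ *: _); rewrite -[RHS](single_id n); congr (single _ _ _).
  apply/funext => l; change (n l + unit_index (h j) l - (l == h j) = n l)%N.
  exact: addnK.
rewrite [RHS]single_out //; case: ifP => // mj.
rewrite single_out ?scaler0 // => E.
apply: mn; apply/funext => l; rewrite -E.
change (m l = m l - (l == h j) + (l == h j))%N; rewrite subnK //.
by case: eqP => // ->.
Qed.

Let base_spec (f : V) := forall n, n <> 0 -> f n = 0.
Let base0 : base_spec 0. Proof. by []. Qed.
Let baseD a f g : base_spec f -> base_spec g -> base_spec (a *: f + g).
Proof.
move=> f0 g0 n n0; change (a *: f n + g n = 0).
by rewrite f0 // g0 // scaler0 addr0.
Qed.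
Let base := comprehension base0 baseD.

Let total := adjoin_all shift (enum J) base.

Let total_shift j f : f \in total -> shift j f \in total.
Proof. by apply: stable_adjoin_all => //; [exact: shiftC|rewrite mem_enum]. Qed.

Let reach_spec n x := single n x \in total.
Let reach0 n : reach_spec n 0.
Proof.
rewrite /reach_spec; have -> : single n 0 = 0.
  by apply/funext => m; rewrite /single; case: ifP.
exact: rpred0.
Qed.
Let reachD n a x x' :
  reach_spec n x -> reach_spec n x' -> reach_spec n (a *: x + x').
Proof. by rewrite /reach_spec singleD => xT x'T; rewrite rpredD ?rpredZ. Qed.

(** The part of multidegree n of the module to which the Hilbert basis theorem
    applies; it contains I^n M by [mpow_reach]. *)
Definition reach n := comprehension (reach0 n) (@reachD n).

Lemma reach_origin x : x \in reach 0.
Proof.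
apply/comprehensionP; apply: sub_adjoin_all; apply/comprehensionP => m.
exact: single_out.
Qed.

Lemma reach_family : rees_family reach.
Proof.
move=> j n x /comprehensionP xT; apply/comprehensionP.
by rewrite /reach_spec -shift_single; apply: total_shift.
Qed.

Hypothesis noeM : noetherian_module M.

Lemma base_acc : acc_under shift [::] base.
Proof.
move=> K ascK _ Kb.
have Q0 t : exists2 f, f \in K t & f 0 = 0 by exists 0; rewrite ?rpred0.
have QD t a x x' : (exists2 f, f \in K t & f 0 = x) ->
    (exists2 f, f \in K t & f 0 = x') ->
    exists2 f, f \in K t & f 0 = a *: x + x'.
  move=> [f fK <-] [g gK <-]; exists (a *: f + g) => //.
  by rewrite rpredD ?rpredZ.
have [t t' tt' x|T TP] :=
    noetherian_acc (K := fun t => comprehension (Q0 t) (QD t)) noeM.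
  move=> /comprehensionP[f fK fx]; apply/comprehensionP; exists f => //.
  exact: ascK fK.
exists T => t f fK.
have /TP/comprehensionP[g gK gf] : f 0 \in comprehension (Q0 t) (QD t).
  by apply/comprehensionP; exists f.
suff -> : f = g by [].
apply/funext => n; have [->|n0] := pselect (n = 0); first by [].
have /comprehensionP fb := Kb _ _ fK; have /comprehensionP gb := Kb _ _ gK.
by rewrite fb ?gb.
Qed.

(** Finite generation of a multigraded submodule K over the multi-Rees algebra:
    K is the smallest stable family containing its own terms of multidegree at
    most U. The submodules generated by the terms of multidegree at most u form
    a chain, and the chain condition gives U. The smallest stable family is
    expressed by quantifying over all stable families Z. *)
Lemma rees_bounded K : rees_family K -> (forall n, {subset K n <= reach n}) ->
  exists U : nat, forall Z, rees_family Z ->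
    (forall m, (forall i, (m i <= U)%N) -> {subset K m <= Z m}) ->
    forall n, {subset K n <= Z n}.
Proof.
move=> Kfam Kreach.
pose below u Z := rees_family Z /\
  forall m, (forall i, (m i <= u)%N) -> {subset K m <= Z m}.
pose gen u (f : V) := f \in total /\
  forall n, f n \in K n /\ forall Z, below u Z -> f n \in Z n.
have gen0 u : gen u 0.
  by split; rewrite ?rpred0 // => n; split=> [|Z _]; exact: rpred0.
have genD u a f g : gen u f -> gen u g -> gen u (a *: f + g).
  move=> [fT fP] [gT gP]; split; first by rewrite rpredD ?rpredZ.
  move=> n; have [fK fZ] := fP n; have [gK gZ] := gP n.
  have -> : (a *: f + g) n = a *: f n + g n by [].
  split=> [|Z bZ]; first by rewrite rpredD ?rpredZ.
  by apply: rpredD; [apply: rpredZ; apply: fZ|apply: gZ].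
have [||t f /comprehensionP[]//|U UP] :=
    hilbert_basis shiftC base_acc (s := enum J)
      (K := fun u => comprehension (gen0 u) (genD u)).
- move=> u u' uu' f /comprehensionP[fT fP]; apply/comprehensionP; split=> // n.
  have [fK fZ] := fP n; split=> // Z [Zfam Zb]; apply: fZ; split=> // m mu.
  by apply: Zb => i; apply: leq_trans uu'.
- move=> u j _ f /comprehensionP[fT fP]; apply/comprehensionP.
  split; first exact: total_shift.
  have shift_in Z n : rees_family Z -> (forall m, f m \in Z m) ->
      shift j f n \in Z n.
    move=> Zfam fZ; rewrite /shift; case: ifP => [nj|_]; last exact: rpred0.
    have {2}-> : n = pred_index n (h j) + unit_index (h j).
      apply/funext => l; change (n l = n l - (l == h j) + (l == h j))%N.
      by rewrite subnK //; case: eqP => // ->.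
    exact/Zfam/fZ.
  move=> n; split; first by apply: shift_in => // m; have [] := fP m.
  move=> Z bZ; apply: shift_in => [|m]; first by case: bZ.
  by have [_] := fP m; apply.
exists U => Z Zfam Zb n x xK.
have /UP/comprehensionP[_ sP] : single n x \in
    comprehension (gen0 (\max_i n i)%N) (genD (\max_i n i)%N).
  apply/comprehensionP; split; first by have /comprehensionP := Kreach n x xK.
  move=> m; have [->|mn] := pselect (m = n).
    rewrite single_id; split=> // Z' [_ Z'b]; apply: Z'b => // i.
    exact: leq_bigmax.
  by rewrite single_out //; split=> [|Z' _]; exact: rpred0.
have [_] := sP n; rewrite single_id; exact.
Qed.

End ReesFamilies.

(** * Gradings, annihilators and saturation *)

Section Components.
Variables (K : eqType) (V : zmodType) (G : K -> {pred V}).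
Hypothesis gradG : is_grading G.
Implicit Types (x : V) (c : K -> V).

Definition is_components x c := (forall i, c i \in G i) /\
  exists s, [/\ uniq s, forall i, i \notin s -> c i = 0
    & x = \sum_(i <- s) c i].

Lemma big_seq_widen (s t : seq K) c : uniq s -> uniq t -> {subset s <= t} ->
  (forall i, i \notin s -> c i = 0) -> \sum_(i <- t) c i = \sum_(i <- s) c i.
Proof.
move=> us ut st c0; rewrite (bigID (mem s)) /= [X in _ + X]big1 ?addr0 //.
rewrite -[LHS]big_filter; apply: perm_big.
apply: uniq_perm; rewrite ?filter_uniq //.
by move=> i; rewrite mem_filter; case is_s: (i \in s) => //=; rewrite st.
Qed.

Lemma components_exist x : exists c, is_components x c.
Proof.
have [z dec _] := gradG; have [s [f [us fG ->]]] := dec x.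
exists (fun i => if i \in s then f i else 0); split=> [i|].
  by case: ifP => [/fG //|_]; have [] := z i.
exists s; split=> // [i /negbTE->//|]; rewrite big_seq [RHS]big_seq.
by apply: eq_bigr => i ->.
Qed.

Lemma components_unique x c c' :
  is_components x c -> is_components x c' -> c =1 c'.
Proof.
have [z _ dir] := gradG.
move=> [cG [s [us c0 xE]]] [c'G [s' [us' c'0 xE']]] i.
set t := undup (s ++ s').
have st : {subset s <= t} by move=> k ks; rewrite mem_undup mem_cat ks.
have s't : {subset s' <= t} by move=> k ks; rewrite mem_undup mem_cat ks orbT.
have it0 k : k \notin t -> c k = 0 /\ c' k = 0.
  rewrite mem_undup mem_cat negb_or => /andP[ks ks'].
  by rewrite c0 ?c'0.
have [it|/it0[-> ->]//] := boolP (i \in t).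
apply/eqP; rewrite -subr_eq0; apply/eqP.
apply: (dir t (fun k => c k - c' k)) => //; first exact: undup_uniq.
  by move=> k _; have [_ ->] := z k.
rewrite sumrB (big_seq_widen us (undup_uniq _) st c0).
by rewrite (big_seq_widen us' (undup_uniq _) s't c'0) -xE -xE' subrr.
Qed.

(** Components are chosen classically; [components_unique] makes them
    independent of the choice. *)
Definition component (i : K) x : V := sval (cid (components_exist x)) i.

Lemma comp_components x : is_components x (component^~ x).
Proof. by rewrite /component; case: cid. Qed.

Lemma compE x c i : is_components x c -> component i x = c i.
Proof. by move=> xc; exact: (components_unique (comp_components x) xc i). Qed.

Lemma comp_mem i x : component i x \in G i.
Proof. by have [] := comp_components x. Qed.

Lemma compD i x y : component i (x + y) = component i x + component i y.
Proof.
have [z _ _] := gradG.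
apply: (compE (c := fun i => component i x + component i y)); split=> [k|].
  have [k0 kB] := z k.
  by rewrite -[component k y]opprK -[- component k y]sub0r !(kB, comp_mem, k0).
have [_ [s [us s0 xE]]] := comp_components x.
have [_ [t [ut t0 yE]]] := comp_components y.
exists (undup (s ++ t)); split=> [|k|]; first exact: undup_uniq.
  rewrite mem_undup mem_cat negb_or => /andP[ks kt].
  by rewrite s0 ?t0 ?addr0.
rewrite big_split /= {1}xE {1}yE; congr (_ + _); symmetry; apply: big_seq_widen;
  by rewrite ?undup_uniq // => k; rewrite mem_undup mem_cat => ->; rewrite ?orbT.
Qed.

Lemma comp0 i : component i 0 = 0.
Proof. by apply: (@addrI _ (component i 0)); rewrite -compD !addr0. Qed.

Lemma comp_sum (Q : Type) (s : seq Q) (P : pred Q) (f : Q -> V) i :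
  component i (\sum_(q <- s | P q) f q) = \sum_(q <- s | P q) component i (f q).
Proof. exact: (big_morph (component i) (compD i) (comp0 i)). Qed.

Lemma comp_hom i j x : x \in G j -> component i x = if i == j then x else 0.
Proof.
have [z _ _] := gradG.
move=> xj; apply: (compE (c := fun i => if i == j then x else 0)).
split=> [k|]; first by case: eqP => [->//|_]; have [] := z k.
exists [:: j]; split=> // [k|]; last by rewrite big_seq1 eqxx.
by rewrite inE => /negbTE->.
Qed.

Lemma comp_id i x : x \in G i -> component i x = x.
Proof. by move=> xi; rewrite (comp_hom i xi) eqxx. Qed.

Lemma comp_decomposes (P : {pred V}) x i : 0 \in P ->
  decomposes (fun i => [predI G i & P]) x -> component i x \in P.
Proof.
move=> P0 [s [f [us fGP xE]]].
rewrite (@compE x (fun i => if i \in s then f i else 0)); last first.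
  split=> [k|]; first case: ifP => [/fGP /andP[]//|_].
    by have [z _ _] := gradG; have [] := z k.
  exists s; split=> // [k /negbTE->//|]; rewrite xE big_seq [RHS]big_seq.
  by apply: eq_bigr => k ->.
by case: ifP => // /fGP /andP[].
Qed.

End Components.

Fact grading_of_ring (R : comPzRingType) (Rg : nat -> {pred R}) :
  ring_grading Rg -> is_grading Rg.
Proof. by case. Qed.

Fact grading_of_module (R : comPzRingType) (Rg : nat -> {pred R})
    (M : lmodType R) (Mg : int -> {pred M}) :
  module_grading Rg Mg -> is_grading Mg.
Proof. by case. Qed.

Section GradedModules.
Variables (R : comPzRingType) (Rg : nat -> {pred R}).
Variables (M : lmodType R) (Mg : int -> {pred M}).
Hypotheses (gradR : ring_grading Rg) (gradM : module_grading Rg Mg).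
Implicit Types (A B N : submod M) (x : M) (p : {pred R}).

Local Notation gradR' := (grading_of_ring gradR).
Local Notation gradM' := (grading_of_module gradM).
Local Notation mcomp := (component gradM').
Local Notation rcomp := (component gradR').

Lemma comp_scale (k : int) (i : nat) (a : R) x :
  a \in Rg i -> mcomp k (a *: x) = a *: mcomp (k - i%:Z) x.
Proof.
move=> ai; apply: (compE gradM' (c := fun k => a *: mcomp (k - i%:Z) x)).
split=> [l|].
  have [_ /(_ _ _ _ _ ai (comp_mem gradM' (l - i%:Z) x))] := gradM.
  by rewrite addrCA subrr addr0.
have [_ [s [us s0 xE]]] := comp_components gradM' x.
exists [seq l + i%:Z | l <- s]; split=> [|l|].
- by rewrite map_inj_uniq //; exact: addIr.
- move=> ls; rewrite s0 ?scaler0 //; apply: contra ls => ls.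
  by apply/mapP; exists (l - i%:Z); rewrite ?subrK.
- rewrite big_map {1}xE scaler_sumr; apply: eq_bigr => l _.
  by rewrite addrK.
Qed.

(** The form in which gradedness of a submodule is used: it contains the
    components of its elements. *)
Definition homogeneous N := forall x, x \in N -> forall k, mcomp k x \in N.

Lemma graded_homogeneous N : graded_submod Mg N -> homogeneous N.
Proof. by move=> gN x /gN dx k; apply: comp_decomposes dx; apply: rpred0. Qed.

Lemma full_homogeneous : homogeneous (full M).
Proof. by []. Qed.

Lemma imul_homogeneous (J : ideal R) N :
  graded_submod (M := R^o) Rg J -> homogeneous N -> homogeneous (imul J N).
Proof.
move=> gJ hN x /asboolP[s [sP ->]] k; rewrite comp_sum big_seq.
apply: rpred_sum => u /sP[/gJ[t [f [_ fJ ->]]] uN].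
rewrite scaler_suml comp_sum big_seq; apply: rpred_sum => i /fJ /andP[fi fJi].
by rewrite (comp_scale _ _ fi); apply: imul_mem => //; apply: hN.
Qed.

Lemma mpow_homogeneous r (I : 'I_r -> ideal R) N n :
  (forall i, graded_submod (M := R^o) Rg (I i)) -> homogeneous N ->
  homogeneous (imul (mpow I n) N).
Proof.
move=> gI hN; elim/multi_index_ind: n => [|n i IH].
  by rewrite mpow0 imul_full_ideal.
by rewrite addrC mpowD mpow_unit -imulA; apply: imul_homogeneous.
Qed.

(** p is the annihilator of the class of x modulo B. Working with this relation
    in M replaces all the quotient modules. *)
Definition is_ann p B x := forall a, (a \in p) = (a *: x \in B).

Section Prime.
Variables (p : {pred R}) (pp : prime_ideal p).

Let pI (a b : R) : a \in p -> b * a \in p.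
Proof.
move=> ap; have [[p0 pD] _ _] := pp.
by have := pD b a 0 ap p0; rewrite addr0.
Qed.

Let pA (a b : R) : a \in p -> b \in p -> a + b \in p.
Proof.
move=> ap bp; have [[p0 pD] _ _] := pp.
by have := pD 1 a b ap bp; rewrite scale1r.
Qed.

Let pM (a b : R) : a \notin p -> b \notin p -> a * b \notin p.
Proof.
move=> ap bp; apply/negP; have [_ _ pr] := pp.
by move=> /pr; rewrite (negbTE ap) (negbTE bp).
Qed.

Fact saturation0 B : exists2 a, a \notin p & a *: (0 : M) \in B.
Proof. by exists 1; rewrite ?scaler0 ?rpred0 //; have [] := pp. Qed.

Fact saturationD B b x y : (exists2 a, a \notin p & a *: x \in B) ->
  (exists2 a, a \notin p & a *: y \in B) ->
  exists2 a, a \notin p & a *: (b *: x + y) \in B.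
Proof.
move=> [a ap ax] [c cp cy]; exists (a * c); first exact: pM.
rewrite scalerDr; apply: rpredD; last by rewrite -scalerA; apply: rpredZ.
by rewrite scalerA -mulrA mulrC -scalerA; apply: rpredZ.
Qed.

(** The kernel of the localization at p of M / B. An element killed by p modulo
    B has annihilator p exactly when it is outside of this submodule, see
    [is_annP]; closure under sums is where primality enters. *)
Definition saturation B := comprehension (saturation0 B) (@saturationD B).

Lemma is_annP B x :
  is_ann p B x <-> (forall a, a \in p -> a *: x \in B) /\ x \notin saturation B.
Proof.
split=> [ax|[px xB] a].
  split=> [a ap|]; first by rewrite -ax.
  by apply/negP => /comprehensionP[a /negP ap]; rewrite -ax.
apply/idP/idP; first exact: px.
move=> axB; apply: contraNT xB => ap; apply/comprehensionP.
by exists a.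
Qed.

Lemma int_range x : exists (lo : int) (m : nat),
  x = \sum_(t < m) mcomp (lo + t%:Z) x.
Proof.
have [_ [s [us s0 xE]]] := comp_components gradM' x.
pose b := (\sum_(i <- s) `|i|)%N.
exists (- b%:Z), b.*2.+1.
rewrite -(big_mkord xpredT (fun t => mcomp (- b%:Z + t%:Z) x)) {1}xE.
rewrite -(big_map (fun t : nat => - b%:Z + t%:Z) xpredT (mcomp^~ x)).
symmetry; apply: big_seq_widen => //.
  by rewrite map_inj_uniq ?iota_uniq // => t t' /addrI [].
move=> i si; have ib : (`|i| <= b)%N by rewrite /b (big_rem i)//= leq_addr.
apply/mapP; exists (absz ((i : int) + b%:Z)); last by lia.
rewrite mem_index_iota; lia.
Qed.

Lemma nat_range (a : R) i :
  exists2 L, (i < L)%N & a = \sum_(0 <= t < L) rcomp t a.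
Proof.
have [_ [s [us s0 aE]]] := comp_components gradR' a.
exists (i + \sum_(i <- s) i).+1; first by rewrite ltnS leq_addr.
rewrite {1}aE; symmetry; apply: big_seq_widen => //; first exact: iota_uniq.
move=> k ks; rewrite mem_index_iota /= ltnS; apply: leq_trans (leq_addl _ _).
by rewrite (big_rem k)//= leq_addr.
Qed.

(** Suppose the lower components of a lie in p, and that x starts in degree lo
    with x_0. The lowest component a_i x_0 of a x then lies in B. If a_i is not
    in p, then a_i x - a_i x_0 still has annihilator p modulo B, and it has
    fewer components than x. *)
Lemma prime_homogeneous B x : homogeneous B -> is_ann p B x ->
  forall a, a \in p -> forall i, rcomp i a \in p.
Proof.
move=> hB; have [lo [m xE]] := int_range x; move: xE.
suff main f : (forall t, f t \in Mg (lo + t%:Z)) ->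
    x = \sum_(t < m) f t -> is_ann p B x ->
    forall a, a \in p -> forall i, rcomp i a \in p.
  move=> xE; apply: (main (fun t => mcomp (lo + t%:Z) x)) => // t.
  exact: comp_mem.
elim: m lo x f => [|m IH] lo x f fM xE annx a ap i.
  have [_ /negP p1 _] := pp; case: p1.
  by rewrite annx xE big_ord0 scaler0 rpred0.
elim/ltn_ind: i => i IHi; apply/negPn/negP => aip.
have compx u : mcomp (lo - u%:Z) x = if u == 0%N then f 0%N else 0.
  rewrite xE comp_sum big_ord_recl /= big1 ?addr0 => [|t _].
    have := fM 0%N; rewrite addr0 => /(comp_hom gradM') ->.
    by case: u => [|u]; rewrite ?subr0 ?eqxx //; case: eqP => //; lia.
  rewrite (comp_hom gradM' _ (fM _)); case: eqP => //= E; move: E.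
  by rewrite /bump; lia.
(* the component of a' x in its lowest degree lo + i *)
have aif : rcomp i a *: f 0%N \in B.
  have [L iL aE] := nat_range a i.
  pose a' := \sum_(i <= t < L) rcomp t a.
  have a'p : a' \in p.
    have -> : a' = (-1) * (\sum_(0 <= t < i) rcomp t a) + a.
      by rewrite {2}aE (big_cat_nat _ (ltnW iL))//= mulN1r addrA addNr add0r.
    apply: pA => //; apply: pI; rewrite big_seq; elim/big_ind: _ => //.
      by have [[]] := pp.
    by move=> t; rewrite mem_index_iota => /andP[_ /IHi].
  have := hB _ _ (lo + i%:Z); rewrite annx in a'p => /(_ _ a'p).
  rewrite scaler_suml comp_sum big_ltn // big_nat_cond big1 => [|t].
    rewrite addr0 (comp_scale _ _ (comp_mem _ _ _)) addrK.
    by rewrite -[lo]subr0 (compx 0%N).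
  rewrite andbT => /andP[it _]; rewrite (comp_scale _ _ (comp_mem _ _ _)).
  have -> : lo + i%:Z - t%:Z = lo - (t - i)%N%:Z by lia.
  by rewrite compx; case: eqP; [lia|rewrite scaler0].
case/negP: (aip).
pose x' := rcomp i a *: x - rcomp i a *: f 0%N.
apply: (IH (lo + 1 + i%:Z) x' (fun t => rcomp i a *: f t.+1)) => // [t||b].
- have [_ /(_ i (lo + t.+1%:Z) _ (f t.+1) (comp_mem gradR' i a))] := gradM.
  by move=> /(_ (fM _)); congr (_ \in Mg _); lia.
- rewrite /x' -scalerBr xE big_ord_recl /= addrC addKr scaler_sumr.
  by apply: eq_bigr.
rewrite scalerBr; apply/idP/idP => [bp|bx].
  apply: rpredB; last exact: rpredZ.
  by rewrite scalerA -annx mulrC; apply: pI.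
have : b *: (rcomp i a *: x) \in B.
  rewrite -[X in X \in B](subrK (b *: (rcomp i a *: f 0%N))).
  by rewrite rpredD // rpredZ.
rewrite scalerA -annx => bap; apply: contraLR bap => bp; exact: pM.
Qed.

Lemma homogeneous_annihilated B :
  (forall a, a \in p -> forall i, rcomp i a \in p) -> homogeneous B ->
  forall x k, (forall a, a \in p -> a *: x \in B) ->
  forall a, a \in p -> a *: mcomp k x \in B.
Proof.
move=> hp hB x k px a ap.
have [_ [s [_ _ ->]]] := comp_components gradR' a.
rewrite scaler_suml; apply: rpred_sum => i _.
have := hB _ (px _ (hp a ap i)) (k + i%:Z).
by rewrite (comp_scale _ _ (comp_mem _ _ _)) addrK.
Qed.

(** Not all the components of x can lie in the saturation of B, which is closed
    under sums. *)
Lemma homogeneous_witness A B x : homogeneous A -> homogeneous B ->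
  x \in A -> is_ann p B x ->
  exists k z, [/\ z \in Mg k, z \in A & is_ann p B z].
Proof.
move=> hA hB xA annx; have hp := prime_homogeneous hB annx.
have [px /negP xB] := (is_annP B x).1 annx.
apply: contrapT => none; apply: xB.
have [_ [s [_ _ ->]]] := comp_components gradM' x.
apply: rpred_sum => k _; apply/negPn/negP => kB; apply: none.
exists k, (mcomp k x); split; [exact: comp_mem|exact: hA|].
by apply/is_annP; split=> //; apply: homogeneous_annihilated.
Qed.

End Prime.

End GradedModules.

(** * Down-closed sets of exponents and eventual minima of affine functions *)

Section DownSets.
Variable J : finType.
Implicit Types (g b : J -> nat) (D : (J -> nat) -> Prop).

Definition down_closed D :=
  forall g g', (forall j, (g j <= g' j)%N) -> D g' -> D g.

(** Along the coordinates in A, either all diagonal points belong to D and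
    there is nothing to bound, or some diagonal point T does not; then a point
    of D has a coordinate below T, and fixing it removes that coordinate. *)
Lemma down_closed_cutoff_on D (A : {set J}) b : down_closed D ->
  exists T, forall g, (forall j, j \notin A -> g j = b j) ->
    D (fun j => if j \in A then minn (g j) T else g j) -> D g.
Proof.
move=> downD; move Ek: #|A| => k; elim/ltn_ind: k A b Ek => k IH A b Ek.
pose diag t j := if j \in A then t else b j.
have [allD|/existsNP[T0 DT0]] := pselect (forall t, D (diag t)).
  exists 0%N => g gb _; apply: downD (allD (\max_j g j)%N) => j; rewrite /diag.
  by case: ifP => [_|/negbT/gb->//]; apply: leq_bigmax.
have /choice[T TP] : forall u : J * nat, exists T, u.1 \in A ->
    forall g,
    (forall j, j \notin A :\ u.1 -> g j = if j == u.1 then u.2 else b j) ->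
    D (fun j => if j \in A :\ u.1 then minn (g j) T else g j) -> D g.
  move=> [j u] /=; have [jA|_] := boolP (j \in A); last by exists 0%N.
  have [|T TP] := IH _ _ (A :\ j) (fun i => if i == j then u else b i) erefl.
    by rewrite -Ek [#|A|](cardsD1 j) jA.
  by exists T => _; apply: TP.
pose T1 := (T0 + \sum_(u : J * 'I_T0) T (u.1, u.2 : nat))%N.
exists T1 => g gb Dg.
have [/existsP[j /andP[jA jT0]]|/existsPn big] :=
    boolP [exists j in A, (g j < T0)%N].
  have TT1 : (T (j, g j) <= T1)%N.
    apply: leq_trans (leq_addl _ _).
    by rewrite (bigD1 (j, Ordinal jT0))//= leq_addr.
  have T0T1 : (T0 <= T1)%N by apply: leq_addr.
  apply: (TP (j, g j)) => // [i|] /=.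
    by rewrite !inE negb_and negbK; case: eqP => [->//|_] /= /gb.
  apply: downD Dg => i; rewrite !inE; case: eqP => [->|_] /=; rewrite ?jA.
    by rewrite leq_min leqnn ltnW // (leq_trans jT0).
  by case: ifP => // _; rewrite leq_min geq_minl (leq_trans (geq_minr _ _)).
case: DT0; apply: downD Dg => j; rewrite /diag; case: ifP => [jA|/negbT/gb->//].
have := big j; rewrite jA /= -leqNgt => gj.
by rewrite leq_min gj leq_addr.
Qed.

(** Dickson's lemma, for the complement of D. *)
Lemma down_closed_cutoff D : down_closed D ->
  exists T, forall g, D (fun j => minn (g j) T) -> D g.
Proof.
move=> downD; have [T TP] := down_closed_cutoff_on [set: J] (fun=> 0%N) downD.
exists T => g Dg; apply: TP => [j|]; first by rewrite inE.
by apply: downD Dg => j; rewrite inE.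
Qed.

End DownSets.

Section MinLinear.
Variables (r : nat) (J : finType) (h : J -> 'I_r) (d : J -> nat).
Implicit Types (n : 'I_r -> nat) (g : J -> nat).
Implicit Types (S : ('I_r -> nat) -> int -> Prop).

Definition degree g : 'I_r -> nat := fun i => (\sum_(j | h j == i) g j)%N.
Definition weight g : nat := (\sum_j d j * g j)%N.

Definition affine_val (u : {ffun 'I_r -> nat} * int) n : int :=
  (\sum_(i < r) u.1 i * n i)%N%:Z + u.2.

Definition slopes_ok (u : {ffun 'I_r -> nat} * int) :=
  forall i, exists2 j, h j = i & u.1 i = d j.

(** For n large, the set S n of integers has the same lower bounds as its finite
    subset of values at n of the affine functions in L. Stating this for sets,
    and with L possibly empty, makes the notion stable under shifts and finite
    unions. *)
Definition eventually_min S := exists2 L : seq ({ffun 'I_r -> nat} * int),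
  forall u, u \in L -> slopes_ok u &
  for_large (fun n => (forall u, u \in L -> S n (affine_val u n)) /\
    forall t, S n t -> exists2 u, u \in L & affine_val u n <= t).

Lemma degree_le g i T :
  (forall j, h j == i -> (g j <= T)%N) -> (degree g i <= #|J| * T)%N.
Proof.
move=> gT; rewrite /degree big_mkcond -sum_nat_const; apply: leq_sum => j _.
by case: ifP => // /gT.
Qed.

Lemma sum_fibers (F : J -> nat) (f : 'I_r -> nat) :
  (\sum_j f (h j) * F j = \sum_i f i * \sum_(j | h j == i) F j)%N.
Proof.
rewrite (partition_big h xpredT)//=; apply: eq_bigr => i _.
by rewrite big_distrr; apply: eq_bigr => j /eqP->.
Qed.

(** The constant term is chosen so that the affine function gives the weight of
    b after raising it along the coordinates s i up to multidegree n. *)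
Lemma affine_decomposition (s : {ffun 'I_r -> J}) b n :
  (forall i, degree b i <= n i)%N ->
  affine_val ([ffun i => d (s i)],
    (weight b)%:Z - (\sum_i d (s i) * degree b i)%N%:Z) n =
  (weight b + \sum_i d (s i) * (n i - degree b i))%N%:Z.
Proof.
move=> bn; rewrite /affine_val /=.
have -> : (\sum_(i < r) [ffun i => d (s i)] i * n i =
    \sum_i d (s i) * degree b i + \sum_i d (s i) * (n i - degree b i))%N.
  rewrite -big_split; apply: eq_bigr => i _ /=.
  by rewrite ffunE -mulnDr subnKC.
by rewrite !PoszD addrC addrA subrK.
Qed.

(** With T a cutoff for D, a point g of D is determined up to D by its
    truncation b at T. Raising g further in degree i costs least along the
    cheapest coordinate s i among those truncated, which is where the slopes
    come from. *)
Lemma eventually_min_down_closed D : down_closed D ->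
  eventually_min (fun n t =>
    exists g, [/\ D g, degree g = n & t = (weight g)%:Z]).
Proof.
move=> downD; have [T TP] := down_closed_cutoff downD.
pose vals (be : {ffun J -> 'I_T.+1}) : J -> nat := fun j => be j.
pose good (u : {ffun J -> 'I_T.+1} * {ffun 'I_r -> J}) :=
  `[< D (vals u.1) >] &&
  [forall i, (h (u.2 i) == i) && (u.1 (u.2 i) == T :> nat)].
pose line (u : {ffun J -> 'I_T.+1} * {ffun 'I_r -> J}) :=
  ([ffun i => d (u.2 i)], (weight (vals u.1))%:Z -
    (\sum_i d (u.2 i) * degree (vals u.1) i)%N%:Z).
have deg_vals be i : (degree (vals be) i <= #|J| * T)%N.
  by apply: degree_le => j _; have := ltn_ord (be j); rewrite ltnS.
exists [seq line u |
    u <- enum {: {ffun J -> 'I_T.+1} * {ffun 'I_r -> J}} & good u].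
  move=> u /mapP[[be s]].
  rewrite mem_filter => /andP[/andP[_ /forallP sP] _] -> i.
  by have /andP[/eqP hi _] := sP i; exists (s i) => //; rewrite ffunE.
(* beyond this bound every fiber of h has a coordinate larger than T *)
exists (fun=> #|J| * T + 1)%N => n nbig.
split=> [u /mapP[[be s]]|_ [g [Dg gn ->]]].
  rewrite mem_filter => /andP[/andP[/asboolP/= Db /forallP sP] _] ->.
  have hs i : h (s i) = i by have /andP[/eqP] := sP i.
  have bn i : (degree (vals be) i <= n i)%N.
    apply: leq_trans (deg_vals be i) _.
    by have := nbig i; rewrite addn1 => /ltnW.
  pose g j :=
    (vals be j + (s (h j) == j) * (n (h j) - degree (vals be) (h j)))%N.
  have fiber i (F : J -> nat) :
      (\sum_(j | h j == i) (s (h j) == j) * F j = F (s i))%N.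
    rewrite (bigD1 (s i)) ?hs //= eqxx mul1n big1 ?addn0 // => j /andP[/eqP<-].
    by rewrite eq_sym => /negbTE->.
  exists g; split; last 1 first.
  - rewrite affine_decomposition //; congr (Posz _).
    rewrite /weight /g; under [RHS]eq_bigr do rewrite mulnDr.
    rewrite big_split /=; congr (_ + _)%N.
    rewrite [RHS](partition_big h xpredT)//=; apply: eq_bigr => i _.
    under [RHS]eq_bigr do rewrite mulnCA.
    by rewrite fiber hs.
  - apply: TP; apply: downD Db => j; rewrite /g.
    case: eqP => [sj|_]; last by rewrite addn0 geq_minl.
    have /andP[_ /eqP] := sP (h j); rewrite sj /vals => ->; exact: geq_minr.
  - apply/funext => i; rewrite /degree /g big_split /= fiber hs.
    exact: (subnKC (bn i)).
pose be : {ffun J -> 'I_T.+1} := [ffun j => inord (minn (g j) T)].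
have beE j : vals be j = minn (g j) T.
  by rewrite /vals ffunE inordK // ltnS geq_minr.
have /choice[s sP] : forall i, exists j, [/\ h j = i, (T < g j)%N &
    forall j', h j' = i -> (T < g j')%N -> (d j <= d j')%N].
  move=> i; pose P j := (h j == i) && (T < g j)%N.
  have [j0 Pj0] : exists j, P j.
    apply/existsP; apply: contraTT (nbig i) => /existsPn noP.
    rewrite -ltnNge addn1 ltnS -gn.
    apply: degree_le => j hj; by have := noP j; rewrite /P hj /= -leqNgt.
  case: (arg_minnP d Pj0) => j /andP[/eqP hj gj] jmin.
  exists j; split=> // j' hj' gj'.
  by apply: jmin; rewrite /P hj' eqxx.
exists (line (be, finfun s)).
  apply: map_f; rewrite mem_filter mem_enum andbT; apply/andP; split.
    by apply/asboolP; apply: downD Dg => j; rewrite beE geq_minl.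
  apply/forallP => i; rewrite ffunE; have [-> gT _] := sP i; rewrite eqxx /=.
  by have := beE (s i); rewrite /vals => ->; rewrite (minn_idPr (ltnW gT)).
have bg j : (vals be j <= g j)%N by rewrite beE geq_minl.
have deg_le i : (degree (vals be) i <= n i)%N by rewrite -gn; apply: leq_sum.
rewrite affine_decomposition // lez_nat.
have -> : (\sum_i d (finfun s i) * (n i - degree (vals be) i) =
    \sum_j d (s (h j)) * (g j - vals be j))%N.
  rewrite (sum_fibers _ (fun i => d (s i))); apply: eq_bigr => i _.
  by rewrite ffunE -gn -sumnB.
rewrite -big_split /=; apply: leq_sum => j _.
rewrite -[in X in (_ <= X)%N](subnKC (bg j)) mulnDr leq_add2l leq_mul2r.
rewrite beE; have [gT|gT] := leqP (g j) T; first by rewrite subnn.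
by have [_ _ ->] := sP (h j); rewrite ?orbT.
Qed.

Lemma eventually_min_shift S (n0 : 'I_r -> nat) (c0 : int) :
  eventually_min S -> eventually_min (fun n t =>
    exists n' t', [/\ n = n' + n0, t = t' + c0 & S n' t']).
Proof.
move=> [L Lok [m LS]].
pose sh (u : {ffun 'I_r -> nat} * int) :=
  (u.1, u.2 + c0 - (\sum_i u.1 i * n0 i)%N%:Z).
have shE u n : affine_val (sh u) (n + n0) = affine_val u n + c0.
  rewrite /affine_val /=.
  have -> : (\sum_(i < r) u.1 i * (n + n0)%R i =
      \sum_i u.1 i * n i + \sum_i u.1 i * n0 i)%N.
    by rewrite -big_split; apply: eq_bigr => i _; apply: mulnDr.
  by rewrite PoszD [u.2 + c0 - _]addrC addrA addrK addrA.
exists [seq sh u | u <- L]; first by move=> _ /mapP[u /Lok uok ->].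
exists (m + n0) => n mn.
have [n' nE n'm] : exists2 n', n = n' + n0 & forall i, (m i <= n' i)%N.
  have le i : (m i + n0 i <= n i)%N by exact: mn.
  exists (fun i => n i - n0 i)%N; last by move=> i; have := le i; lia.
  apply/funext => i; change (n i = n i - n0 i + n0 i)%N; rewrite subnK //.
  by apply: leq_trans (le i); exact: leq_addl.
have [LS1 LS2] := LS n' n'm; rewrite nE; split.
  move=> _ /mapP[u uL ->]; exists n', (affine_val u n').
  by rewrite shE; split=> //; exact: LS1.
move=> _ [n'' [t' [E -> /= St']]].
have E' : n'' = n'.
  apply/funext => i; have /(congr1 (fun f => f i)) := E; move/eqP.
  by rewrite !fctE eqn_add2r => /eqP.
move: St'; rewrite E' => /LS2[u uL ut]; exists (sh u); first exact: map_f.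
by rewrite shE lerD2r.
Qed.

Lemma eventually_min_bigcup (Q : finType)
    (S : Q -> ('I_r -> nat) -> int -> Prop) :
  (forall q, eventually_min (S q)) ->
  eventually_min (fun n t => exists q, S q n t).
Proof.
move=> evS.
have /choice[Lm LmP] : forall q,
    exists Lm : seq ({ffun 'I_r -> nat} * int) * ('I_r -> nat),
    (forall u, u \in Lm.1 -> slopes_ok u) /\
    forall n, (forall i, (Lm.2 i <= n i)%N) ->
     (forall u, u \in Lm.1 -> S q n (affine_val u n)) /\
     forall t, S q n t -> exists2 u, u \in Lm.1 & affine_val u n <= t.
  by move=> q; have [L Lok [m mP]] := evS q; exists (L, m).
exists (flatten [seq (Lm q).1 | q <- enum Q]).
  by move=> u /flatten_mapP[q _]; have [ok _] := LmP q; apply: ok.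
exists (fun i => \sum_q (Lm q).2 i)%N => n mn.
have qn q i : ((Lm q).2 i <= n i)%N.
  by apply: leq_trans (mn i); rewrite (bigD1 q)//= leq_addr.
split=> [u /flatten_mapP[q _]|t [q]].
  by have [_ /(_ n (qn q))[Su _] /Su] := LmP q; exists q.
have [_ /(_ n (qn q))[_ Sle] /Sle[u uL ut]] := LmP q; exists u => //.
by apply/flatten_mapP; exists q => //; rewrite mem_enum.
Qed.

Lemma eventually_min_cofinal S S' : eventually_min S ->
  for_large (fun n => (forall t, S n t -> S' n t) /\
    forall t, S' n t -> exists2 t', S n t' & t' <= t) ->
  eventually_min S'.
Proof.
move=> [L Lok [m LS]] [m' SS']; exists L => //.
exists (fun i => maxn (m i) (m' i)) => n mn.
have [LS1 LS2] : _ /\ _ := LS n (fun i => leq_trans (leq_maxl _ _) (mn i)).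
have [S1 S2] : _ /\ _ := SS' n (fun i => leq_trans (leq_maxr _ _) (mn i)).
split=> [u /LS1 /S1//|t /S2[t' /LS2[u uL ut'] t't]].
by exists u => //; apply: le_trans t't.
Qed.

End MinLinear.

(** * Monomials in the generators of the ideals *)

Section MultiReesFamilies.
Variables (R : comPzRingType) (M : lmodType R) (r : nat) (I : 'I_r -> ideal R).
Variables (J : finType) (h : J -> 'I_r) (y : J -> R).
Hypothesis yI : forall j, y j \in I (h j).
Hypothesis genI : forall i a, a \in I i ->
  exists c : J -> R, a = \sum_(j | h j == i) c j * y j.
Implicit Types (n m : 'I_r -> nat) (N : submod M).
Implicit Types (Z : ('I_r -> nat) -> submod M).

Lemma mpow_family N : rees_family h y (fun n => imul (mpow I n) N).
Proof.
move=> j n x xN; rewrite addrC mpowD mpow_unit -imulA.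
by apply: imul_mem.
Qed.

Lemma rees_family_mpow Z : rees_family h y Z ->
  forall n m a x, a \in mpow I n -> x \in Z m -> a *: x \in Z (m + n).
Proof.
move=> Zfam; elim/multi_index_ind => [|n i IH] m a x.
  by rewrite addr0 => _; apply: rpredZ.
rewrite mpowD mpow_unit => /asboolP[s [sP ->]] xZ.
rewrite scaler_suml big_seq; apply: rpred_sum => u /sP[un /genI[c cE]].
have -> : (u.1 *: u.2) *: x = (u.1 : R) *: ((u.2 : R) *: x) by rewrite scalerA.
rewrite addrCA addrC; apply: IH => //.
rewrite cE scaler_suml; apply: rpred_sum => j /eqP<-.
by rewrite -scalerA; apply: rpredZ; apply: Zfam.
Qed.

Lemma mpow_reach n : {subset imul (mpow I n) (full M) <= reach M h y n}.
Proof.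
apply: imul_sub => a x an _; rewrite -[n]add0r.
apply: (rees_family_mpow (Z := reach M h y)) => //; last exact: reach_origin.
exact: reach_family.
Qed.

Lemma multi_rees_bounded (K : ('I_r -> nat) -> submod M) :
  noetherian_module M -> rees_family h y K ->
  (forall n, {subset K n <= imul (mpow I n) (full M)}) ->
  exists U : nat, forall Z, rees_family h y Z ->
    (forall m, (forall i, (m i <= U)%N) -> {subset K m <= Z m}) ->
    forall n, {subset K n <= Z n}.
Proof.
move=> noeM Kfam Ksub; apply: rees_bounded => // n x /Ksub; exact: mpow_reach.
Qed.

Definition mono (g : J -> nat) : R := \prod_j y j ^+ g j.

Lemma degree_sum (g : J -> nat) :
  degree h g = \sum_j (unit_index (h j) *+ g j).
Proof.
apply/funext => i; rewrite fct_sumE /degree big_mkcond; apply: eq_bigr => j _.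
elim: (g j) => [|k IH]; first by rewrite mulr0n; case: ifP.
by rewrite mulrS; change ((if h j == i then k.+1 else 0%N) =
  (i == h j) + (unit_index (h j) *+ k) i)%N; rewrite -IH eq_sym; case: eqP.
Qed.

Lemma mono_family Z g n x :
  rees_family h y Z -> x \in Z n -> mono g *: x \in Z (degree h g + n).
Proof.
move=> Zfam xZ; rewrite /mono degree_sum.
elim: (index_enum J) => [|j s IH]; first by rewrite !big_nil scale1r add0r.
rewrite !big_cons -addrA -scalerA.
elim: (g j) => [|k IHk]; first by rewrite expr0 scale1r mulr0n add0r.
by rewrite exprS mulrS -addrA addrC -scalerA; apply: Zfam.
Qed.

Lemma degreeD g g' : degree h (g + g') = degree h g + degree h g'.
Proof. by apply/funext => i; exact: big_split. Qed.

Lemma monoD g g' : mono (g + g') = mono g * mono g'.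
Proof. by rewrite /mono -big_split; apply: eq_bigr => j _; exact: exprD. Qed.

Lemma mono_unit (j : J) : mono (fun i => (i == j : nat)) = y j.
Proof.
rewrite /mono (bigD1 j)//= eqxx expr1 big1 ?mulr1 // => i /negbTE->.
by rewrite expr0.
Qed.

Lemma degree_unit (j : J) :
  degree h (fun i => (i == j : nat)) = unit_index (h j).
Proof.
apply/funext => i; rewrite /degree /unit_index eq_sym.
have [<-|hji] := eqVneq (h j) i.
  by rewrite (bigD1 j)//= eqxx big1 // => l /andP[_ /negbTE->].
by apply: big1 => l /eqP hl; case: eqP => // lj; rewrite -hl lj eqxx in hji.
Qed.

End MultiReesFamilies.

(** * The degrees realizing an associated prime *)

Section Span.
Variables (R : comPzRingType) (M : lmodType R) (P : M -> Prop).

Let in_all x := forall Z : submod M, (forall z, P z -> z \in Z) -> x \in Z.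
Let in_all0 : in_all 0. Proof. by move=> Z _; exact: rpred0. Qed.
Let in_allD a x y : in_all x -> in_all y -> in_all (a *: x + y).
Proof. by move=> hx hy Z PZ; rewrite rpredD ?rpredZ ?hx ?hy. Qed.

(** The intersection of all submodules containing P; with this form, a property
    of the span is proved by exhibiting one submodule. *)
Definition span := comprehension in_all0 in_allD.

Lemma span_mem z : P z -> z \in span.
Proof. by move=> Pz; apply/comprehensionP => Z; apply. Qed.

Lemma span_sub (Z : submod M) :
  (forall z, P z -> z \in Z) -> {subset span <= Z}.
Proof. by move=> PZ x /comprehensionP; apply. Qed.

End Span.

Lemma scale_preimage (R : comPzRingType) (M : lmodType R) (b : R)
    (N : submod M) :
  exists N' : submod M, forall x, x \in N' <-> b *: x \in N.
Proof.
have P0 : b *: (0 : M) \in N by rewrite scaler0 rpred0.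
have PD a (x y : M) : b *: x \in N -> b *: y \in N -> b *: (a *: x + y) \in N.
  move=> bx by_; rewrite scalerDr; apply: rpredD => //.
  by rewrite scalerA mulrC -scalerA rpredZ.
by exists (comprehension P0 PD) => x; apply: comprehensionP.
Qed.

Section VNumber.
Variables (R : comPzRingType) (Rg : nat -> {pred R}).
Variables (M : lmodType R) (Mg : int -> {pred M}).
Hypotheses (gradR : ring_grading Rg) (gradM : module_grading Rg Mg).
Hypothesis noeM : noetherian_module M.
Variables (r : nat) (I : 'I_r -> ideal R).
Variables (J : finType) (h : J -> 'I_r) (d : J -> nat) (y : J -> R).
Hypothesis yI : forall j, y j \in I (h j).
Hypothesis yd : forall j, y j \in Rg (d j).
Hypothesis genI : forall i a, a \in I i ->
  exists c : J -> R, a = \sum_(j | h j == i) c j * y j.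
Hypothesis gradI : forall i, graded_submod (M := R^o) Rg (I i).

Local Notation rcomp := (component (grading_of_ring gradR)).
Local Notation mcomp := (component (grading_of_module gradM)).

Lemma mono_homogeneous (g : J -> nat) : mono y g \in Rg (weight d g).
Proof.
have [_ R1 RM] := gradR; rewrite /mono /weight.
elim: (index_enum J) => [|j s IH]; first by rewrite !big_nil.
rewrite !big_cons; apply: (RM) => //.
elim: (g j) => [|k IHk]; first by rewrite muln0.
by rewrite exprS mulnS; apply: RM.
Qed.

Lemma homogeneous_generators (K : submod M) : homogeneous gradM K ->
  exists L : seq (int * M),
    (forall u, u \in L -> u.2 \in Mg u.1 /\ u.2 \in K) /\
    forall Z : submod M, (forall u, u \in L -> u.2 \in Z) -> {subset K <= Z}.
Proof.
move=> hK; have [k [z genK]] := noeM K.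
have /choice[s sP] : forall i,
    exists s : seq int, z i = \sum_(t <- s) mcomp t (z i).
  move=> i; have [_ [s [_ _]]] :=
    comp_components (grading_of_module gradM) (z i).
  by exists s.
exists (flatten [seq [seq (t, mcomp t (z i)) | t <- s i] | i <- enum 'I_k]).
split=> [u /flatten_mapP[i _ /mapP[t _ ->]]|Z ZP x /genK[c ->]].
  by split; [exact: comp_mem|apply: hK; exact: generates_mem genK].
apply: rpred_sum => i _; apply: rpredZ; rewrite sP big_seq.
apply: rpred_sum => t ts; apply: (ZP (t, mcomp t (z i))).
apply/flatten_mapP; exists i; rewrite ?mem_enum //.
by apply/mapP; exists t.
Qed.

Variables (N : submod M) (p : {pred R}).
Hypothesis hN : homogeneous gradM N.
Hypothesis pp : prime_ideal p.
Hypothesis hp : forall a, a \in p -> forall i, rcomp i a \in p.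
Implicit Types (n : 'I_r -> nat) (t : int).

Local Notation IM n := (imul (mpow I n) (full M)).
Local Notation IN n := (imul (mpow I n) N).

(** The set of degrees whose infimum is the local Vasconcelos number at n. *)
Definition realizes n t :=
  exists x, [/\ x \in Mg t, x \in IM n & is_ann p (IN n) x].

Lemma colon_family : exists K : ('I_r -> nat) -> submod M,
  [/\ forall n x,
        x \in K n <-> x \in IM n /\ forall a, a \in p -> a *: x \in IN n,
    rees_family h y K & forall n, homogeneous gradM (K n)].
Proof.
pose P n x := x \in IM n /\ forall a, a \in p -> a *: x \in IN n.
have P0 n : P n 0.
  by split=> [|a _]; rewrite ?scaler0; exact: rpred0.
have PD n b x z : P n x -> P n z -> P n (b *: x + z).
  move=> [xM px] [zM pz]; split=> [|a ap]; first by rewrite rpredD ?rpredZ.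
  rewrite scalerDr scalerA mulrC -scalerA.
  by apply: rpredD; [apply: rpredZ; apply: px|apply: pz].
exists (fun n => comprehension (P0 n) (PD n)); split=> [n x|j n x|n x].
- exact: comprehensionP.
- move=> /comprehensionP[xM px]; apply/comprehensionP.
  split=> [|a ap]; first exact: mpow_family.
  rewrite scalerA mulrC -scalerA; apply: mpow_family; first exact: yI.
  exact: px.
- move=> /comprehensionP[xM px] k; apply/comprehensionP; split.
    exact: (mpow_homogeneous (gradM := gradM)).
  move=> a ap; apply: (homogeneous_annihilated hp _ k px ap).
  exact: mpow_homogeneous.
Qed.

(** The numerators killed by p form a finitely generated module over the
    multi-Rees algebra. For a homogeneous generator x, the exponents g for
    which the annihilator of y^g x is exactly p form a down-closed set; and if
    z has annihilator p, then one of the monomials y^g x occurring in z has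
    annihilator p and degree at most that of z, as otherwise an element
    outside of p kills all of them. *)
Lemma realizes_eventually_min : eventually_min h d realizes.
Proof.
have hIN n : homogeneous gradM (IN n) by apply: mpow_homogeneous.
have [K [KP Kfam hK]] := colon_family.
have KM n : {subset K n <= IM n} by move=> x /KP[].
have [U UP] := multi_rees_bounded genI noeM Kfam KM.
have /choice[L LP] m := homogeneous_generators (hK m).
pose mu (f : {ffun 'I_r -> 'I_U.+1}) : 'I_r -> nat := fun i => f i.
pose Q := {f : {ffun 'I_r -> 'I_U.+1} & 'I_(size (L (mu f)))}.
pose nq (q : Q) := mu (tag q).
pose cx (q : Q) := nth (0, 0) (L (nq q)) (tagged q).
have cxP q : (cx q).2 \in Mg (cx q).1 /\ (cx q).2 \in K (nq q).
  by have [LK _] := LP (nq q); apply: LK; apply: mem_nth.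
pose sat n := saturation pp (IN n).
pose D q g := mono y g *: (cx q).2 \notin sat (degree h g + nq q).
have Ddown q : down_closed (D q).
  move=> g g' gg'; apply: contra => /comprehensionP[a ap ax].
  apply/comprehensionP; exists a => //.
  pose e j := (g' j - g j)%N.
  have -> : g' = e + g.
    by apply/funext => j; change (g' j = g' j - g j + g j)%N; rewrite subnK.
  have -> : a *: (mono y (e + g) *: (cx q).2) =
      mono y e *: (a *: (mono y g *: (cx q).2)).
    by rewrite monoD !scalerA mulrCA mulrA.
  rewrite degreeD -addrA.
  exact: (mono_family (Z := fun n => IN n) e (mpow_family yI (N := N)) ax).
pose S (q : Q) n t := exists n' t', [/\ n = n' + nq q, t = t' + (cx q).1 &
  exists g, [/\ D q g, degree h g = n' & t' = (weight d g)%:Z]].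
have evS : eventually_min h d (fun n t => exists q, S q n t).
  apply: eventually_min_bigcup => q; apply: eventually_min_shift.
  exact: eventually_min_down_closed.
have monoK q g : mono y g *: (cx q).2 \in K (degree h g + nq q).
  by apply: mono_family => //; have [] := cxP q.
have mono_deg q g : mono y g *: (cx q).2 \in Mg ((weight d g)%:Z + (cx q).1).
  have [_ MP] := gradM; have [cxg _] := cxP q.
  by apply: MP cxg; exact: mono_homogeneous.
apply: (eventually_min_cofinal evS); exists (fun=> 0%N) => n _; split=> t.
  move=> [q [_ [_ [-> -> [g [Dg <- ->]]]]]].
  exists (mono y g *: (cx q).2); split=> //; first exact: KM.
  by apply/(is_annP pp); split=> //; have /KP[] := monoK q g.
move=> [z [zt zM annz]].
apply: contrapT => none.
have [pz /negP zsat] := (is_annP pp _ _).1 annz; apply: zsat.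
pose Z m := span (fun w =>
  exists q g, m = degree h g + nq q /\ w = mono y g *: (cx q).2).
have Zfam : rees_family h y Z.
  move=> j m x xZ.
  have [Z' Z'P] := scale_preimage (y j) (Z (m + unit_index (h j))).
  apply/Z'P; apply: span_sub x xZ => _ [q [g [mE ->]]].
  apply/Z'P; rewrite mE; apply: span_mem.
  exists q, ((fun i => (i == j : nat)) + g).
  rewrite degreeD degree_unit monoD mono_unit scalerA; split=> //.
  by rewrite -[RHS]addrA addrC.
have KZ m : (forall i, (m i <= U)%N) -> {subset K m <= Z m}.
  move=> mU; pose f : {ffun 'I_r -> 'I_U.+1} := [ffun i => inord (m i)].
  have muf : mu f = m by apply/funext => i; rewrite /mu ffunE inordK ?ltnS.
  have [_ LK] := LP m; apply: LK => u uL; apply: span_mem.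
  have uf : (index u (L (mu f)) < size (L (mu f)))%N by rewrite index_mem muf.
  exists (Tagged (fun f => 'I_(size (L (mu f)))) (Ordinal uf) : Q), 0.
  rewrite /cx /nq /= nth_index ?muf //; split.
    apply/funext => i; rewrite /degree.
    by change (m i = (\sum_(j | h j == i) 0 + m i)%N); rewrite big1.
  by rewrite /mono big1 ?scale1r // => j _; rewrite expr0.
(* The condition ranges over all t' <= t because multiplication by a moves
   components upwards. *)
have low0 : forall t', t' <= t -> mcomp t' 0 \in sat n.
  by move=> t' _; rewrite comp0 rpred0.
have lowD a x x' : (forall t', t' <= t -> mcomp t' x \in sat n) ->
    (forall t', t' <= t -> mcomp t' x' \in sat n) ->
    forall t', t' <= t -> mcomp t' (a *: x + x') \in sat n.
  move=> xs x's t' t't; rewrite compD; apply: rpredD; last exact: x's.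
  have [_ [s [_ _ ->]]] := comp_components (grading_of_ring gradR) a.
  rewrite scaler_suml comp_sum; apply: rpred_sum => i _.
  rewrite (comp_scale gradM _ _ (comp_mem _ _ _)); apply: rpredZ; apply: xs.
  by apply: le_trans t't; rewrite gerBl.
have zZ : z \in Z n by apply: UP => //; apply/KP.
suff : z \in comprehension low0 lowD.
  by move=> /comprehensionP /(_ t (lexx t)); rewrite comp_id.
apply: span_sub _ zZ => w [q [g [nE wE]]].
apply/comprehensionP => t' t't; rewrite wE (comp_hom _ _ (mono_deg q g)).
case: eqP => [t'E|_]; last exact: rpred0.
apply/negPn/negP => wsat; apply: none; exists t' => //.
exists q, (degree h g), (weight d g)%:Z; split=> //.
by exists g; split=> //; rewrite /D -nE.
Qed.
End VNumber.

(** * Stability of colon submodules *)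

Section ColonStability.
Variables (R : comPzRingType) (M : lmodType R) (r : nat) (I : 'I_r -> ideal R).
Variables (J : finType) (h : J -> 'I_r) (y : J -> R).
Hypothesis yI : forall j, y j \in I (h j).
Hypothesis genI : forall i a, a \in I i ->
  exists c : J -> R, a = \sum_(j | h j == i) c j * y j.
Hypotheses (noeR : noetherian R) (fgM : finitely_generated (full M)).
Implicit Types (n m : 'I_r -> nat).

Local Notation IM n := (imul (mpow I n) (full M)).

(** Such an f is the sum of its coordinates, each embedded into its own factor
    by a linear map. *)
Lemma imul_coordinates (f : J -> M) (K : ideal R) :
  (forall j, f j \in imul K (full M)) -> f \in imul K (full (J -> M)).
Proof.
move=> fK; pose delta j (x : M) : J -> M := fun l => if l == j then x else 0.
have -> : f = \sum_j delta j (f j).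
  apply/funext => l; rewrite fct_sumE (bigD1 l)//= {1}/delta eqxx big1 ?addr0 //.
  by move=> j; rewrite /delta eq_sym => /negbTE->.
apply: rpred_sum => j _; have /asboolP[s [sP ->]] := fK j.
have -> : delta j (\sum_(u <- s) u.1 *: u.2) = \sum_(u <- s) u.1 *: delta j u.2.
  apply/funext => l; rewrite fct_sumE /delta.
  under [RHS]eq_bigr => u _.
    have -> : (u.1 *: (fun l0 => if l0 == j then u.2 else 0) : J -> M) l =
      if l == j then u.1 *: u.2 else 0.
      change (u.1 *: (if l == j then u.2 else 0) =
        if l == j then u.1 *: u.2 else 0).
      by case: ifP; rewrite ?scaler0.
    over.
  by case: ifP => // _; rewrite big1.
rewrite big_seq; apply: rpred_sum => u /sP[uK _]; exact: imul_mem.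
Qed.

Lemma mpow_le n m (N : submod M) :
  {subset imul (mpow I (n + m)) N <= imul (mpow I n) N}.
Proof.
by move=> x; rewrite mpowD -imulA; apply: imul_monoN; exact: imul_subN.
Qed.

(** By finite generation, the family of the (I^(n + e_i) M : I_i), embedded in a
    power of M through multiplication by the y_j, is the smallest stable family
    containing its terms of multidegree at most U. Replacing the n-th term by
    I^n M as soon as n_i > U gives a smaller family that is still stable, as the
    step from n_i = U to U + 1 multiplies by an element of I_i. *)
Lemma colon_stable i :
  (forall x : M, (forall a, a \in I i -> a *: x = 0) -> x = 0) ->
  exists U : nat, forall n, (U < n i)%N -> forall x,
    (forall a, a \in I i -> a *: x \in IM (n + unit_index i)) -> x \in IM n.
Proof.
move=> inj.
pose phi (x : M) : J -> M := fun j => if h j == i then y j *: x else 0.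
have phiD a x x' : phi (a *: x + x') = a *: phi x + phi x'.
  apply/funext => j; change (phi (a *: x + x') j = a *: phi x j + phi x' j).
  rewrite /phi; case: ifP => _; last by rewrite scaler0 addr0.
  by rewrite scalerDr !scalerA mulrC.
have phi0 : phi 0 = 0.
  by apply/funext => j; rewrite /phi scaler0; case: ifP.
have phiZ a x : phi (a *: x) = a *: phi x.
  by rewrite -[a *: x]addr0 phiD phi0 addr0.
have phi_inj x x' : phi x = phi x' -> x = x'.
  move=> E; apply/eqP; rewrite -subr_eq0; apply/eqP/inj => a /genI[c ->].
  rewrite scaler_suml big1 // => j hj; rewrite -scalerA scalerBr.
  have := congr1 (fun f => f j) E; rewrite /phi hj => ->.
  by rewrite subrr scaler0.
pose colonI n x := forall a, a \in I i -> a *: x \in IM (n + unit_index i).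
pose P (b : ('I_r -> nat) -> bool) n f :=
  exists2 x, f = phi x & if b n then (x \in IM n : Prop) else colonI n x.
have P0 b n : P b n 0.
  exists 0; rewrite ?phi0 //; case: (b n); first exact: rpred0.
  by move=> a _; rewrite scaler0; exact: rpred0.
have PD b n a f g : P b n f -> P b n g -> P b n (a *: f + g).
  move=> [x -> xb] [z -> zb]; exists (a *: x + z); first by rewrite phiD.
  move: xb zb; case: (b n) => xb zb; first by rewrite rpredD ?rpredZ.
  move=> c ci; rewrite scalerDr scalerA mulrC -scalerA.
  by apply: rpredD; [apply: rpredZ; apply: xb|apply: zb].
pose K n := comprehension (P0 (fun=> false) n) (PD (fun=> false) n).
have colon_family j n x :
    colonI n x -> colonI (n + unit_index (h j)) (y j *: x).
  move=> cx a ai; rewrite scalerA mulrC -scalerA addrAC.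
  by apply: (mpow_family yI); apply: cx.
have Kfam : rees_family h y K.
  move=> j n f /comprehensionP[x -> cx]; apply/comprehensionP.
  by exists (y j *: x); [rewrite phiZ|apply: colon_family].
have KM n : {subset K n <= imul (mpow I n) (full (J -> M))}.
  move=> f /comprehensionP[x -> cx]; apply: imul_coordinates => j.
  rewrite /phi; case: eqP => [hj|_]; last exact: rpred0.
  by apply: mpow_le; apply: cx; rewrite -hj.
have noeJM : noetherian_module (J -> M).
  by apply: noetherian_fg_module => //; apply: fg_full_power.
have [U UP] := multi_rees_bounded genI noeJM Kfam KM.
exists U => n Un x cx.
pose b n := (U < n i)%N.
suff : phi x \in comprehension (P0 b n) (PD b n).
  by move=> /comprehensionP[x' /phi_inj->]; rewrite /b Un.
apply: (UP (fun n => comprehension (P0 b n) (PD b n))) => [j m f|m mU f|].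
- move=> /comprehensionP[z -> zb]; apply/comprehensionP.
  exists (y j *: z); first by rewrite phiZ.
  move: zb; rewrite /b; case: ltnP => [Um zM|mU cz].
    have -> : (U < (m + unit_index (h j))%R i)%N by exact: ltn_addr.
    exact: (mpow_family yI).
  case: ifP => [Um|_]; last exact: colon_family.
  suff hj : h j = i by rewrite hj; apply: cz; rewrite -hj.
  apply/eqP; move: Um; change ((U < m i + (i == h j))%N -> h j == i).
  by rewrite eq_sym; case: eqP => //; lia.
- move=> /comprehensionP[z -> cz]; apply/comprehensionP; exists z => //.
  by rewrite /b ltnNge mU.
- by apply/comprehensionP; exists x.
Qed.

End ColonStability.

Lemma prime_mpow (R : comPzRingType) (p : {pred R}) r (I : 'I_r -> ideal R) n :
  prime_ideal p -> {subset mpow I n <= p} -> exists i, {subset I i <= p}.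
Proof.
move=> [_ p1 pr]; elim/multi_index_ind: n => [|n i IH].
  by rewrite mpow0 => /(_ 1 isT) /(negP p1).
rewrite mpowD mpow_unit => np.
have [|/existsNP[b /not_implyP[bI /negP bp]]] :=
    pselect (forall b, b \in I i -> b \in p).
  by exists i.
apply: IH => a an; have /np/pr : a * b \in imul (mpow I n) (I i).
  exact: (@imul_mem R R^o).
by rewrite (negbTE bp) orbF.
Qed.

(** * Quotient modules and infima *)

Section QuotientTranslation.
Variables (R : comPzRingType) (M : lmodType R) (Mg : int -> {pred M}).
Implicit Types (A B : submod M) (p : {pred R}) (x : M) (t : int).

Lemma quot_scaleE B a x :
  a *: (\pi_(Quotient.quot B) x : quot_mod B) = \pi_(Quotient.quot B) (a *: x).
Proof. exact: quot_scale_pi. Qed.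

Lemma quot_eq0 B x : ((\pi_(Quotient.quot B) x : quot_mod B) == 0) = (x \in B).
Proof.
have -> : (0 : quot_mod B) = \pi_(Quotient.quot B) 0 by rewrite raddf0.
by rewrite -Quotient.idealrBE subr0.
Qed.

Lemma ann_quot p B x :
  (p =i ann (\pi_(Quotient.quot B) x : quot_mod B)) <-> is_ann p B x.
Proof.
by split=> e a; have := e a; rewrite inE quot_scaleE quot_eq0.
Qed.

Lemma Ass_quot p B :
  Ass (quot_mod B) p <-> prime_ideal p /\ exists x, is_ann p B x.
Proof.
split=> [[pp [u e]]|[pp [x e]]]; split=> //.
  by exists (repr u); apply/ann_quot; rewrite reprK.
by exists (\pi_(Quotient.quot B) x); apply/ann_quot.
Qed.

Lemma quot_realized p B t :
  (exists2 u, u \in quot_grading Mg B t & p =i ann u) <->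
  exists x, x \in Mg t /\ is_ann p B x.
Proof.
split=> [[u /asboolP[x xt ->]] /ann_quot px|[x [xt px]]]; first by exists x.
exists (\pi_(Quotient.quot B) x); last exact/ann_quot.
by apply/asboolP; exists x.
Qed.

Lemma is_ann_restr p A B (v : submod_type A) :
  is_ann p (restr A B) v <-> is_ann p B (val v).
Proof.
have E a : (a *: v \in restr A B) = (a *: val v \in B).
  by rewrite inE (linearZZ (\val : {linear submod_type A -> M})).
by split=> e a; rewrite e E.
Qed.

End QuotientTranslation.

Section SubquotientTranslation.
Variables (R : comPzRingType) (M : lmodType R) (Mg : int -> {pred M}).
Implicit Types (A B : submod M) (p : {pred R}) (x : M) (t : int).

Lemma Ass_subquot p A B : Ass (subquot A B) p <->
  prime_ideal p /\ exists2 x, x \in A & is_ann p B x.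
Proof.
split=> [/Ass_quot[pp [v /is_ann_restr e]]|[pp [x xA e]]].
  by split=> //; exists (val v) => //; exact: valP v.
by apply/Ass_quot; split=> //; exists (SubmodElt xA); apply/is_ann_restr.
Qed.

Lemma subquot_realized p A B t :
  (exists2 u, u \in subquot_grading Mg A B t & p =i ann u) <->
  exists x, [/\ x \in Mg t, x \in A & is_ann p B x].
Proof.
split=> [/quot_realized[v [vt /is_ann_restr e]]|[x [xt xA e]]].
  by exists (val v); split=> //; exact: valP v.
by apply/quot_realized; exists (SubmodElt xA); split=> //; apply/is_ann_restr.
Qed.

End SubquotientTranslation.

Definition int_inf (S : int -> Prop) : \bar int :=
  infimum +oo%E [set t%:E%E | t in [set t | S t]]%classic.

Lemma vnum_quot (R : comPzRingType) (M : lmodType R) (Mg : int -> {pred M})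
    (p : {pred R}) (B : submod M) : vnum (quot_grading Mg B) p =
  int_inf (fun t => exists x, x \in Mg t /\ is_ann p B x).
Proof.
rewrite /vnum /int_inf; congr infimum; congr image.
by apply/funext => t; apply/propext; exact: quot_realized.
Qed.

Lemma vnum_subquot (R : comPzRingType) (M : lmodType R) (Mg : int -> {pred M})
    (p : {pred R}) (A B : submod M) : vnum (subquot_grading Mg A B) p =
  int_inf (fun t => exists x, [/\ x \in Mg t, x \in A & is_ann p B x]).
Proof.
rewrite /vnum /int_inf; congr infimum; congr image.
by apply/funext => t; apply/propext; exact: subquot_realized.
Qed.

(** Stated with an enumeration of candidates that bound S from below, so that
    the infimum is attained. *)
Lemma int_inf_min (S : int -> Prop) s (f : 'I_s -> int) :
  (0 < s)%N -> (forall k, S (f k)) -> (forall t, S t -> exists k, f k <= t) ->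
  int_inf S = \big[Order.min/+oo%E]_(k < s) (f k)%:E%E.
Proof.
case: s f => // s f _ Sf fS.
have [k _ kmin] := Order.TotalTheory.arg_minP f (i0 := ord0) (P := xpredT) isT.
have -> : \big[Order.min/+oo%E]_(k < s.+1) (f k)%:E%E = (f k)%:E%E.
  apply/le_anti/andP; split; first exact: bigmin_le.
  by apply: le_bigmin => [|i _]; rewrite ?leey // lee_fin; apply: kmin.
have infk : infimums [set t%:E%E | t in [set t | S t]]%classic (f k)%:E%E.
  split=> [_ [t St <-]|b]; last by apply; exists (f k).
  have [l lt] := fS t St; rewrite lee_fin; apply: le_trans lt; exact: kmin.
rewrite /int_inf /infimum; case: ifPn => [/eqP E|_].
  have : (f k)%:E%E \in [set t%:E%E | t in [set t | S t]]%classic.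
    by apply/mem_set; exists (f k).
  by rewrite E inE.
by apply: is_subset1_infimums (infk); apply: xgetPex; exists (f k)%:E%E.
Qed.

Section Conclusion.
Variables (r : nat) (a : 'I_r -> nat) (d : forall i, 'I_(a i) -> nat).

Local Notation J := {i : 'I_r & 'I_(a i)}.
Local Notation dJ := (fun j : J => d (tagged j)).

Lemma eventually_min_linearW (S : ('I_r -> nat) -> int -> Prop) v :
  eventually_min (tag : J -> 'I_r) dJ S ->
  for_large (fun n => exists t, S n t) ->
  for_large (fun n => v n = int_inf (S n)) -> eventually_min_linear d v.
Proof.
move=> [L Lok [m1 LS]] [m2 S0] [m3 vS].
have Lin k : nth ([ffun=> 0%N], 0) L (k : 'I_(size L)) \in L by exact: mem_nth.
exists (size L).
exists (fun k : 'I_(size L) => (nth ([ffun=> 0%N], 0) L k).1 : 'I_r -> nat).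
exists (fun k : 'I_(size L) => (nth ([ffun=> 0%N], 0) L k).2); split.
- (* L is not empty since S n is not, for one large n *)
  pose n i := maxn (m1 i) (m2 i).
  have [t] := S0 n (fun i => leq_maxr _ _).
  move=> /(proj2 (LS n (fun i => leq_maxl _ _)))[u].
  by case: (L).
- move=> k i; have [[i' j] /= hij ->] := Lok _ (Lin k) i.
  by case: _ / hij; exists j.
exists (fun i => m1 i + (m2 i + m3 i))%N => n mn.
have [L1 L2] : _ /\ _ := LS n (fun i => leq_trans (leq_addr _ _) (mn i)).
have [t St] : exists t, S n t.
  by apply: S0 => i; apply: leq_trans (mn i); rewrite addnCA leq_addr.
rewrite vS => [|i]; last by apply: leq_trans (mn i); rewrite addnA leq_addl.
apply: int_inf_min => [|k|t' /L2[u uL ut]].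
- by have [u] := L2 t St; case: (L).
- exact: L1 (Lin k).
- have uk : (index u L < size L)%N by rewrite index_mem.
  by exists (Ordinal uk); rewrite /= nth_index.
Qed.

End Conclusion.

(** * Asymptotic linearity of the local Vasconcelos number *)

(** Index all the generators of all the ideals by one finite type, so that
    exponents of monomials are plain functions on it. *)
Lemma generators_family (R : comPzRingType) (Rg : nat -> {pred R}) r
    (I : 'I_r -> ideal R) (a : 'I_r -> nat) (d : forall i, 'I_(a i) -> nat) :
  (forall i, generated_in_degrees Rg (I i) (d i)) ->
  exists y : {i : 'I_r & 'I_(a i)} -> R,
    [/\ forall j, y j \in I (tag j), forall j, y j \in Rg (d (tag j) (tagged j))
      & forall i b, b \in I i ->
          exists c, b =
            \sum_(j : {i : 'I_r & 'I_(a i)} | tag j == i) c j * y j].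
Proof.
move=> gen; pose z i := sval (cid (gen i)).
have zP i : (forall j, z i j \in Rg (d i j)) /\ generates (z i) (I i).
  by rewrite /z; case: cid.
exists (fun j => z (tag j) (tagged j)); split=> [j|j|i b /(proj2 (zP i))[c ->]].
- by apply: generates_mem; have [] := zP (tag j).
- by have [] := zP (tag j).
elim/big_ind: _ => [|x x' [e ->] [e' ->]|j _].
- by exists (fun=> 0); rewrite big1 // => j _; rewrite mul0r.
- exists (fun j => e j + e' j); rewrite -big_split; apply: eq_bigr => j _.
  by rewrite mulrDl.
pose j0 : {i : 'I_r & 'I_(a i)} := Tagged (fun i => 'I_(a i)) j.
exists (fun l => if l == j0 then c j else 0).
rewrite (bigD1 j0)//= eqxx big1 ?addr0 // => l /andP[_ /negbTE->].
by rewrite mul0r.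
Qed.

Theorem theorem1p5 (R : comPzRingType) (Rg : nat -> {pred R})
    (M : lmodType R) (Mg : int -> {pred M}) (N : submod M)
    (r : nat) (I : 'I_r -> ideal R)
    (a : 'I_r -> nat) (d : forall i : 'I_r, 'I_(a i) -> nat)
    (cA cB cBI : set {pred R}) :
  let IM n := imul (mpow I n) (full M) in
  let IN n := imul (mpow I n) N in
  let n1 (n : 'I_r -> nat) := fun i => (n i + 1)%N in
  noetherian R -> ring_grading Rg ->
  finitely_generated (full M) -> module_grading Rg Mg ->
  graded_submod Mg N ->
  (forall i, graded_submod (M := R^o) Rg (I i)) ->
  (forall i, generated_in_degrees Rg (I i) (d i)) ->
  stable_value (fun n => Ass (quot_mod (IN n))) cA ->
  stable_value (fun n => Ass (subquot (IM n) (IN n))) cB ->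
  stable_value (fun n => Ass (subquot (IM n) (IN (n1 n)))) cBI ->
  [/\ forall p, cB p ->
        eventually_min_linear d
          (fun n => vnum (subquot_grading Mg (IM n) (IN n)) p),
      (forall k, colon (pred1 (0 : M)) (I k) =i pred1 0) ->
      (exists s, {subset IM s <= N}) ->
      forall p, cA p ->
        eventually_min_linear d (fun n => vnum (quot_grading Mg (IN n)) p)
    & (forall k, colon (pred1 (0 : M)) (I k) =i pred1 0) ->
      (exists s, {subset IM s <= N}) ->
      forall p, cBI p ->
        cA p /\
        for_large (fun n =>
          vnum (subquot_grading Mg (IM n) (IN (n1 n))) p =
          vnum (quot_grading Mg (IN (n1 n))) p)].
Proof.
move=> IM IN n1 noeR gradR fgM gradM gN gI gen [mA stA] [mB stB] [mBI stBI].
have noeM : noetherian_module M by exact: noetherian_fg_module.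
have [y [yI yd genI]] := generators_family gen.
have hN : homogeneous gradM N by exact: graded_homogeneous.
have hIN N' n : homogeneous gradM N' -> homogeneous gradM (imul (mpow I n) N').
  exact: mpow_homogeneous.
have hM : homogeneous gradM (full M) by exact: full_homogeneous.
(* Some I_i lies in p; an element with annihilator p modulo I^(n + e_i) N then
   lies in (I^(n + e_i) M : I_i), which is I^n M. *)
have inside p : prime_ideal p -> (exists n x, is_ann p (IN n) x) ->
    (forall k, colon (pred1 (0 : M)) (I k) =i pred1 0) ->
    (exists s, {subset IM s <= N}) ->
    exists i (U : nat), forall n, (U < n i)%N ->
      forall x, is_ann p (IN (n + unit_index i)) x -> x \in IM n.
  move=> pp [n0 [x0 e0]] inj [s sN].
  have [i ip] : exists i, {subset I i <= p}.
    apply: (prime_mpow (n := n0 + s) pp) => b bns.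
    rewrite e0; have : b *: x0 \in IM (n0 + s) by exact: imul_mem.
    rewrite /IM mpowD -imulA; exact: imul_monoN.
  have inji (x : M) : (forall b, b \in I i -> b *: x = 0) -> x = 0.
    move=> kill; apply/eqP; have := inj i x; rewrite [RHS]inE => <-.
    by apply/asboolP => b bI; rewrite inE kill.
  have [U UP] := colon_stable yI genI noeR fgM inji.
  exists i, U => n Un x e; apply: UP => // b bI.
  by have := ip b bI; rewrite e; apply: imul_monoN.
have realized N' p : homogeneous gradM N' -> prime_ideal p ->
    (exists n x, is_ann p (imul (mpow I n) N') x) ->
    eventually_min (tag : {i : 'I_r & 'I_(a i)} -> 'I_r)
      (fun j : {i : 'I_r & 'I_(a i)} => d (tag j) (tagged j))
      (realizes Mg I N' p).
  move=> hN' pp [n [x e]].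
  apply: (realizes_eventually_min (gradR := gradR) noeM yI yd genI gI hN' pp).
  exact: prime_homogeneous (hIN _ _ hN') e.
split.
- move=> p pB.
  have prime_wit n : (forall i, (mB i <= n i)%N) ->
      prime_ideal p /\ exists2 x, x \in IM n & is_ann p (IN n) x.
    by move=> /stB E; apply/Ass_subquot; rewrite E.
  have [pp [x0 _ e0]] := prime_wit mB (fun=> leqnn _).
  apply: (eventually_min_linearW (realized N p hN pp _)).
  + by exists mB, x0.
  + exists mB => n /prime_wit[_ [x xM e]].
    have [k [z zP]] :=
      homogeneous_witness gradR pp (hIN _ n hM) (hIN _ n hN) xM e.
    by exists k, z.
  + by exists mB => n _; apply: vnum_subquot.
- move=> inj sN p pA.
  have prime_wit n : (forall i, (mA i <= n i)%N) ->
      prime_ideal p /\ exists x, is_ann p (IN n) x.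
    by move=> /stA E; apply/Ass_quot; rewrite E.
  have [pp wit] := prime_wit mA (fun=> leqnn _).
  have [i [U UP]] := inside p pp (ex_intro _ mA wit) inj sN.
  have INi n : imul (mpow I n) (imul (I i) N) = IN (n + unit_index i).
    by rewrite imulA -[I i]mpow_unit -mpowD.
  have hN' : homogeneous gradM (imul (I i) N) by exact: imul_homogeneous.
  pose S n t := exists x, x \in Mg t /\ is_ann p (IN n) x.
  apply: (eventually_min_linearW (S := S)).
  + have ev : eventually_min _ _ _ := realized (imul (I i) N) p hN' pp _.
    (* I^(n + e_i) N = I^n (I_i N), so the shift by e_i of the first part for
       I_i N computes the invariant for N *)
    apply: (eventually_min_cofinal
      (eventually_min_shift (unit_index i) 0 (ev _))).
      exists mA; have [|_ [x e]] := prime_wit (mA + unit_index i) _;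
        last by exists x; rewrite INi.
      by move=> j; exact: leq_addr.
    exists (fun=> U.+2) => n Un; split=> t.
      by move=> [n' [t' [-> -> [x [xt _]]]]]; rewrite INi addr0 => e; exists x.
    move=> [x [xt e]]; exists t => //.
    pose n' j := (n j - (j == i))%N.
    have nE : n = n' + unit_index i.
      apply/funext => j; change (n j = n j - (j == i) + (j == i))%N.
      by rewrite subnK //; apply: leq_trans (Un j); case: eqP.
    exists n', t; rewrite addr0; split=> //; exists x; split=> //.
      by apply: UP; rewrite -?nE // /n' eqxx; have := Un i; lia.
    by rewrite INi -nE.
  + exists mA => n /prime_wit[_ [x e]].
    have xM : x \in full M by [].
    have [k [z [zk _ ez]]] :=
      homogeneous_witness gradR pp hM (hIN _ n hN) xM e.
    by exists k, z.
  + by exists mA => n _; apply: vnum_quot.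
- move=> inj sN p pBI.
  have prime_wit n : (forall i, (mBI i <= n i)%N) ->
      prime_ideal p /\ exists2 x, x \in IM n & is_ann p (IN (n1 n)) x.
    by move=> /stBI E; apply/Ass_subquot; rewrite E.
  split.
    pose n i := maxn (mA i) (mBI i).
    have [pp [x _ e]] := prime_wit n (fun i => leq_maxr _ _).
    rewrite -(stA (n1 n)); first by apply/Ass_quot; split=> //; exists x.
    by move=> i; apply: leq_trans (leq_maxl _ _) (leq_addr _ _).
  have [pp [x0 _ e0]] := prime_wit mBI (fun=> leqnn _).
  have wit : exists n x, is_ann p (IN n) x by exists (n1 mBI), x0.
  have [i [U UP]] := inside p pp wit inj sN.
  exists (fun=> U.+1) => n Un; rewrite vnum_subquot vnum_quot; congr int_inf.
  apply/funext => t; apply/propext.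
  split=> [[x [xt _ e]]|[x [xt e]]]; first by exists x.
  exists x; split=> //.
  pose k j : nat := (j != i).
  have n1E : n1 n = n + k + unit_index i.
    apply/funext => j; change (n j + 1 = n j + (j != i) + (j == i))%N.
    by rewrite -addnA; congr addn; case: (j == i).
  have : x \in IM (n + k).
    by apply: UP; rewrite -?n1E //; apply: leq_trans (leq_addr _ _); exact: Un.
  exact: mpow_le.
Qed.
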